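(* Let $T$ be any contractive co-hyponormal unilateral backward weighted shift operator in $B_1(\mathbb D)$. If $\mathcal K_T(w_0)=-(1-|w_0|^2)^{-2}$ for some $w_0\in\mathbb D$, then $T$ is unitarily equivalent to $U_+^*$, the backward shift operator.
   Context: $\mathbb D$ is the open unit disc. A bounded operator $T$ on a complex separable Hilbert space $\mathcal H$ is in $B_1(\mathbb D)$ if $\dim\ker(T-wI)=1$ and $T-wI$ has closed range for each $w\in\mathbb D$, and the closed linear span of $\bigcup_{w\in\mathbb D}\ker(T-wI)$ is $\mathcal H$. The curvature of $T$ is $\mathcal K_T(w)=-\frac{\partial^2}{\partial w\,\partial\bar w}\log\|\gamma(w)\|^2$, where $\gamma$ is any local non-vanishing holomorphic map with $\gamma(w)\in\ker(T-wI)$. $T$ is a unilateral backward weighted shift if its adjoint is a unilateral forward weighted shift, i.e. there are an orthonormal basis $\{e_n\}_{n\ge0}$ of $\mathcal H$ and scalars $\lambda_n$ with $T^*e_n=\lambda_ne_{n+1}$ for all $n\ge0$. $T$ is co-hyponormal if $T^*$ is hyponormal, i.e. $TT^*\ge T^*T$. $U_+$ is the (unweighted) forward unilateral shift on $\ell^2(\mathbb N)$ and $U_+^*$ is its adjoint. *)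

(* Defs.v *)
From HB Require Import structures.
From mathcomp Require Import all_boot all_order all_algebra.
From mathcomp Require Import all_classical all_reals all_analysis.
From mathcomp Require Import complex ring lra.

Set Implicit Arguments.
Unset Strict Implicit.
Unset Printing Implicit Defensive.

Import Order.TTheory GRing.Theory Num.Theory.
Import numFieldNormedType.Exports.
Local Open Scope classical_set_scope.
Local Open Scope ring_scope.

(* Complex Hilbert spaces: complete normed spaces over R[i] whose norm comes
   from an inner product, linear on the left and conjugate-linear on the right.
   Since R[i] is partially ordered, 0 <= z means that z is real and >= 0, and
   norms are (nonnegative real) elements of R[i]. *)
HB.mixin Record NormedModule_hasInner (R : realType) H
    of NormedModule R[i] H := {
  inner : {dot H for (@Num.conj R[i])} ;
  norm_innerE : forall x : H, `|x| ^+ 2 = inner x x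
}.

#[short(type="hilbertType")]
HB.structure Definition Hilbert (R : realType) :=
  {H of CompleteNormedModule R[i] H & NormedModule_hasInner R H}.

Section ComplexSeries.
Variable R : realType.
Local Notation C := R[i].
Implicit Types (z : C) (u v f g : nat -> C).

Definition sqmod z : R := complex.Re (`|z| ^+ 2).

Lemma sqmodE z : sqmod z = complex.Re z ^+ 2 + complex.Im z ^+ 2.
Proof. by rewrite /sqmod -add_Re2_Im2. Qed.

Lemma sqmod_ge0 z : 0 <= sqmod z.
Proof. by rewrite sqmodE addr_ge0// sqr_ge0. Qed.

Lemma sqmodC z : (sqmod z)%:C%C = `|z| ^+ 2.
Proof. by rewrite sqmodE add_Re2_Im2. Qed.

Lemma cReD z w : complex.Re (z + w) = complex.Re z + complex.Re w.
Proof. by case: z w => ? ? []. Qed.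
Lemma cImD z w : complex.Im (z + w) = complex.Im z + complex.Im w.
Proof. by case: z w => ? ? []. Qed.

Lemma cReB z w : complex.Re (z - w) = complex.Re z - complex.Re w.
Proof. by case: z w => ? ? []. Qed.
Lemma cImB z w : complex.Im (z - w) = complex.Im z - complex.Im w.
Proof. by case: z w => ? ? []. Qed.
Lemma cReM z w :
  complex.Re (z * w) = complex.Re z * complex.Re w - complex.Im z * complex.Im w.
Proof. by case: z w => ? ? []. Qed.
Lemma cImM z w :
  complex.Im (z * w) = complex.Re z * complex.Im w + complex.Im z * complex.Re w.
Proof. by case: z w => ? ? []. Qed.
Lemma cRe_conj z : complex.Re z^* = complex.Re z. Proof. by case: z. Qed.
Lemma cIm_conj z : complex.Im z^* = - complex.Im z. Proof. by case: z. Qed.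

Definition csummable u :=
  cvgn (series (fun n => complex.Re (u n))) /\
  cvgn (series (fun n => complex.Im (u n))).

Definition csum u : C :=
  (limn (series (fun n => complex.Re (u n))) +i*
   limn (series (fun n => complex.Im (u n))))%C.

Lemma csumD u v : csummable u -> csummable v ->
  csummable (fun n => u n + v n) /\
  csum (fun n => u n + v n) = csum u + csum v.
Proof.
have ReD : (fun n => complex.Re (u n + v n)) =
    (fun n => complex.Re (u n)) + (fun n => complex.Re (v n)).
  by apply/funext => n /=; rewrite cReD.
have ImD : (fun n => complex.Im (u n + v n)) =
    (fun n => complex.Im (u n)) + (fun n => complex.Im (v n)).
  by apply/funext => n /=; rewrite cImD.
move=> [u1 u2] [v1 v2]; rewrite /csummable /csum ReD ImD; split.
  by split; exact: is_cvg_seriesD.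
by rewrite !lim_seriesD.
Qed.

Lemma csumZ (a : C) u : csummable u ->
  csummable (fun n => a * u n) /\ csum (fun n => a * u n) = a * csum u.
Proof.
case: a => a b.
have ReZ : (fun n => complex.Re ((a +i* b)%C * u n)) =
    a *: (fun n => complex.Re (u n)) - b *: (fun n => complex.Im (u n)).
  by apply/funext => n; rewrite cReM.
have ImZ : (fun n => complex.Im ((a +i* b)%C * u n)) =
    a *: (fun n => complex.Im (u n)) + b *: (fun n => complex.Re (u n)).
  by apply/funext => n; rewrite cImM.
move=> [u1 u2]; rewrite /csummable /csum ReZ ImZ; split.
  split; [apply: is_cvg_seriesB|apply: is_cvg_seriesD]; exact: is_cvg_seriesZ.
rewrite lim_seriesB ?lim_seriesD; do ?exact: is_cvg_seriesZ.
by rewrite !lim_seriesZ.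
Qed.

Lemma csum_conj u : csummable u -> csum (fun n => (u n)^*) = (csum u)^*.
Proof.
have Re_c : (fun n => complex.Re ((u n)^*)) = (fun n => complex.Re (u n)).
  by apply/funext => n; rewrite cRe_conj.
have Im_c : (fun n => complex.Im ((u n)^*)) = - (fun n => complex.Im (u n)).
  by apply/funext => n; rewrite cIm_conj.
by move=> [u1 u2]; rewrite /csum Re_c Im_c lim_seriesN.
Qed.

Lemma limn_series_shift (a : nat -> R) : a 0%N = 0 ->
  limn (series a) = limn (series (fun n => a n.+1)).
Proof.
move=> a0; have -> : series (fun n => a n.+1) = (fun n => series a n.+1).
  by apply/funext => n; rewrite /series/= big_nat_recl//= a0 add0r.
congr (lim _); apply/seteqP; split => A /=.
  by move=> [N _ NA]; exists N => // n /= Nn; apply: NA => /=; exact: leqW.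
by move=> [N _ NA]; exists N.+1 => // -[//|n] /= Nn; exact: NA.
Qed.

Lemma csum_shift u : u 0%N = 0 -> csum u = csum (fun n => u n.+1).
Proof.
by move=> u0; rewrite /csum; congr (_ +i* _)%C;
  apply: limn_series_shift; rewrite u0.
Qed.

Definition square_summable : {pred nat -> C} :=
  fun f => `[< cvgn (series (fun n => sqmod (f n))) >].

Lemma square_summableP f :
  reflect (cvgn (series (fun n => sqmod (f n)))) (f \in square_summable).
Proof. exact: asboolP. Qed.

Lemma dom_series (a b : nat -> R) : (forall n, `|a n| <= b n) ->
  cvgn (series b) -> cvgn (series a).
Proof.
move=> ab cb; apply: normed_cvg.
apply: (series_le_cvg _ _ ab cb) => n; first exact: normr_ge0.
exact: le_trans (normr_ge0 _) (ab n).
Qed.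

Lemma le_cRe_mul z w : `|complex.Re (z * w^*)| <= sqmod z + sqmod w.
Proof.
rewrite cReM cRe_conj cIm_conj !sqmodE ler_norml.
move: (complex.Re z) (complex.Im z) (complex.Re w) (complex.Im w) => a b c d.
have := sqr_ge0 (a - c); have := sqr_ge0 (a + c); have := sqr_ge0 (b - d).
have := sqr_ge0 (b + d); have := sqr_ge0 a; have := sqr_ge0 b.
have := sqr_ge0 c; have := sqr_ge0 d.
by move=> *; apply/andP; split; nra.
Qed.

Lemma le_cIm_mul z w : `|complex.Im (z * w^*)| <= sqmod z + sqmod w.
Proof.
rewrite cImM cRe_conj cIm_conj !sqmodE ler_norml.
move: (complex.Re z) (complex.Im z) (complex.Re w) (complex.Im w) => a b c d.
have := sqr_ge0 (a - d); have := sqr_ge0 (a + d); have := sqr_ge0 (b - c).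
have := sqr_ge0 (b + c); have := sqr_ge0 a; have := sqr_ge0 b.
have := sqr_ge0 c; have := sqr_ge0 d.
by move=> *; apply/andP; split; nra.
Qed.

Lemma sqmodDM a z w :
  sqmod (a * z + w) <= (sqmod a *+ 2) * sqmod z + 2 * sqmod w.
Proof.
rewrite !sqmodE cReD cImD cReM cImM.
move: (complex.Re z) (complex.Im z) (complex.Re w) (complex.Im w) => c d x y.
move: (complex.Re a) (complex.Im a) => {}a b.
have := sqr_ge0 (a * c - b * d - x); have := sqr_ge0 (a * d + b * c - y).
by rewrite mulr2n; nra.
Qed.

Lemma bounded_square_summable (g : nat -> C) (M : R) :
  (forall N, \sum_(0 <= k < N) sqmod (g k) <= M) -> g \in square_summable.
Proof.
move=> gM; apply/square_summableP; apply: nondecreasing_is_cvgn.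
  apply/nondecreasing_seqP => n.
  by rewrite /series/= big_nat_recr//= lerDl sqmod_ge0.
by exists M => _ [n _ <-]; exact: gM.
Qed.

Lemma csummable_mul f g : f \in square_summable -> g \in square_summable ->
  csummable (fun n => f n * (g n)^*).
Proof.
move=> /square_summableP cf /square_summableP cg.
have cfg := is_cvg_seriesD cf cg.
by split; apply: dom_series cfg => n; [exact: le_cRe_mul|exact: le_cIm_mul].
Qed.

Lemma square_summable_submod_closed : submod_closed square_summable.
Proof.
split.
  apply/square_summableP.
  rewrite [X in series X](_ : _ = fun=> 0).
    rewrite /series/= [X in cvgn X](_ : _ = fun=> 0); first exact: is_cvg_cst.
    by apply/funext => n; rewrite big1.
  by apply/funext => n; rewrite sqmodE/= expr0n addr0.
move=> a f g /square_summableP cf /square_summableP cg; apply/square_summableP.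
have := is_cvg_seriesD (@is_cvg_seriesZ _ _ (sqmod a *+ 2) cf)
                       (@is_cvg_seriesZ _ _ 2 cg).
apply: dom_series => n; rewrite ger0_norm ?sqmod_ge0//; exact: sqmodDM.
Qed.

HB.instance Definition _ := GRing.isSubmodClosed.Build _ _ square_summable
  square_summable_submod_closed.

Record l2 := L2 { l2val :> nat -> C ; _ : l2val \in square_summable }.

HB.instance Definition _ := [isSub for l2val].
HB.instance Definition _ := [Choice of l2 by <:].
HB.instance Definition _ := [SubChoice_isSubLmodule of l2 by <:].

Implicit Types x y : l2.

Lemma l2_in x : (x : nat -> C) \in square_summable. Proof. exact: valP x. Qed.
Hint Resolve l2_in : core.

Lemma l2_lin a x y n : (a *: x + y) n = a * x n + y n. Proof. by []. Qed.
Lemma l2B x y n : (x - y) n = x n - y n. Proof. by []. Qed.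

Definition l2_inner x y : C := csum (fun n => x n * (y n)^*).

Let l2_cs x y : csummable (fun n => x n * (y n)^*).
Proof. exact: csummable_mul. Qed.

Lemma l2_innerC x y : l2_inner x y = (l2_inner y x)^*.
Proof.
rewrite /l2_inner -csum_conj//; congr csum.
by apply/funext => n; rewrite rmorphM /= conjCK mulrC.
Qed.

Lemma l2_inner_linl t : linear_for *%R (l2_inner^~ t).
Proof.
move=> a x y; rewrite /l2_inner.
have [cs <-] := csumZ a (l2_cs x t).
have [_ <-] := csumD cs (l2_cs y t).
by congr csum; apply/funext => n; rewrite l2_lin mulrDl mulrA.
Qed.

Lemma l2_inner_linr t : linear_for (Num.conj \; *%R) (l2_inner t).
Proof.
move=> a x y; rewrite l2_innerC l2_inner_linl rmorphD rmorphM /=.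
by rewrite -!l2_innerC.
Qed.

HB.instance Definition _ :=
  bilinear_isBilinear.Build C l2 l2 C *%R (Num.conj \; *%R) l2_inner
    (l2_inner_linl, l2_inner_linr).

Lemma l2_inner_herm x y : l2_inner x y = (-1) ^+ false * (l2_inner y x)^*.
Proof. by rewrite expr0 mul1r; exact: l2_innerC. Qed.

HB.instance Definition _ :=
  isHermitianSesquilinear.Build C l2 false Num.conj l2_inner l2_inner_herm.

Lemma l2_innerxx x :
  l2_inner x x = (limn (series (fun n => sqmod (x n))))%:C%C.
Proof.
have -> : l2_inner x x = csum (fun n => (sqmod (x n))%:C%C).
  by congr csum; apply/funext => n; rewrite sqmodC normCK.
rewrite /csum /=; congr (_ +i* _)%C.
rewrite [X in limn X](_ : _ = fun=> 0) ?lim_cst//.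
by apply/funext => n; rewrite /series/= big1.
Qed.

Lemma sqmod_le_sum x N : \sum_(0 <= k < N) sqmod (x k) <=
  limn (series (fun n => sqmod (x n))).
Proof.
apply: (@nondecreasing_cvgn_le _ (series (fun n => sqmod (x n)))).
  by apply/nondecreasing_seqP => n; rewrite /series/= big_nat_recr//= lerDl sqmod_ge0.
exact/square_summableP.
Qed.

Lemma l2_inner_gt0 x : x != 0 -> 0 < l2_inner x x.
Proof.
move=> x0; rewrite l2_innerxx ltcR.
have [n xn0] : exists n, x n != 0.
  apply: contrapT => /forallNP x_0; case/eqP: x0; apply/val_inj/funext => n /=.
  by have /negP := x_0 n; rewrite negbK => /eqP.
apply: lt_le_trans (sqmod_le_sum x n.+1).
rewrite big_nat_recr//= ltr_wpDl//; first by apply: sumr_ge0 => *; exact: sqmod_ge0.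
by rewrite -ltcR sqmodC exprn_gt0// normr_gt0.
Qed.

HB.instance Definition _ := isDotProduct.Build C l2 l2_inner l2_inner_gt0.

Section DotNorm.
Variables (U : lmodType C) (form : {dot U for (@Num.conj C)}).

Lemma dot_CS (u v : U) : `|form u v| ^+ 2 <= form u u * form v v.
Proof.
have [-> | v0] := eqVneq v 0.
  by rewrite !linear0r normr0 expr0n.
pose a := form u v / form v v; pose w := u - a *: v.
have wv : form w v = 0.
  by rewrite /w linearBl/= linearZl_LR divfK ?dnorm_eq0 ?subrr.
have vw : form v w = 0 by rewrite hermC/= wv rmorph0 mulr0.
have -> : form u v = a * form v v by rewrite divfK ?dnorm_eq0.
have -> : form u u = `|a| ^+ 2 * form v v + form w w.
  rewrite -dnormZ -hnormDd; last by rewrite linearZl_LR/= vw mulr0.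
  by rewrite /w addrC subrK.
rewrite normrM (ger0_norm (dnorm_ge0 _ _)) exprMn mulrDl.
by rewrite [form v v ^+ 2]expr2 mulrA lerDl mulr_ge0// dnorm_ge0.
Qed.

Lemma dot_triangle (u v : U) :
  sqrtC (form (u + v) (u + v)) <= sqrtC (form u u) + sqrtC (form v v).
Proof.
rewrite -ler_sqr ?rpredD ?nnegrE ?sqrtC_ge0 ?dnorm_ge0// sqrrD !sqrtCK dnormD.
rewrite [leRHS]addrAC lerD2l -mulr_natr.
rewrite -[form u v + _](divfK (negbT (pnatr_eq0 C 2))).
rewrite ler_pM2r ?ltr0n//.
have [h _] := leif_Re_Creal (form u v); rewrite -ReE; apply: le_trans h _.
rewrite -ler_sqr ?nnegrE ?mulr_ge0 ?sqrtC_ge0 ?dnorm_ge0// exprMn !sqrtCK.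
exact: dot_CS.
Qed.

End DotNorm.

Lemma dot_sqrtZ (U : lmodType C) (form : {dot U for (@Num.conj C)}) a (u : U) :
  sqrtC (form (a *: u) (a *: u)) = `|a| * sqrtC (form u u).
Proof.
rewrite dnormZ sqrtCM ?nnegrE ?exprn_ge0 ?dnorm_ge0//.
by rewrite sqrCK.
Qed.

Definition l2_norm x : C := sqrtC (l2_inner x x).

Lemma l2_normD x y : l2_norm (x + y) <= l2_norm x + l2_norm y.
Proof. exact: dot_triangle. Qed.

Lemma l2_normZ a x : l2_norm (a *: x) = `|a| * l2_norm x.
Proof. exact: dot_sqrtZ. Qed.

Lemma l2_norm0 x : l2_norm x = 0 -> x = 0.
Proof. by move/eqP; rewrite /l2_norm sqrtC_eq0 dnorm_eq0 => /eqP. Qed.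

HB.instance Definition _ := Lmodule_isNormed.Build C l2 l2_normD l2_normZ l2_norm0.

Lemma l2_normE x : `|x| ^+ 2 = l2_inner x x.
Proof. exact: sqrtCK. Qed.

Lemma l2_norm_le x (e : R) : 0 <= e ->
  (`|x| <= e%:C%C) <-> forall N, \sum_(0 <= k < N) sqmod (x k) <= e ^+ 2.
Proof.
move=> e0; rewrite -ler_sqr ?nnegrE ?normr_ge0 ?ler0c// l2_normE l2_innerxx -rmorphXn/= lecR.
split=> [le_e N|le_e]; first exact: le_trans (sqmod_le_sum _ _) le_e.
apply: limr_le; first exact/square_summableP.
by near=> N; exact: le_e.
Unshelve. all: by end_near. Qed.

Lemma l2_coord x n : `|x n| <= `|x|.
Proof.
rewrite -ler_sqr ?nnegrE// l2_normE l2_innerxx -sqmodC lecR.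
apply: le_trans (sqmod_le_sum x n.+1).
by rewrite big_nat_recr//= lerDr; apply: sumr_ge0 => *; exact: sqmod_ge0.
Qed.

Lemma cRe_le z : `|complex.Re z|%:C%C <= `|z|.
Proof.
rewrite -ler_sqr ?nnegrE ?normr_ge0 ?ler0c// -sqmodC -rmorphXn/= lecR sqmodE real_normK ?num_real//.
by rewrite lerDl sqr_ge0.
Qed.

Lemma cIm_le z : `|complex.Im z|%:C%C <= `|z|.
Proof.
rewrite -ler_sqr ?nnegrE ?normr_ge0 ?ler0c// -sqmodC -rmorphXn/= lecR sqmodE real_normK ?num_real//.
by rewrite lerDr sqr_ge0.
Qed.

Lemma l2_coord_cvg (h : C -> R) (F : set_system l2) : ProperFilter F ->
  cauchy_ex F -> (forall z, `|h z|%:C%C <= `|z|) -> {morph h : z w / z - w} ->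
  forall n, cvg (h (x n) @[x --> F]).
Proof.
move=> FF Fc hle hB n; apply: R_complete; apply: cauchy_exP => e e0.
have eC : 0 < e%:C%C by rewrite ltcR.
have [x Fx] := Fc _ eC; exists (h (x n)).
suff : F [set y : l2 | `|h (x n) - h (y n)| < e] by [].
apply: filterS Fx => y; rewrite -ball_normE /= => xy.
rewrite -ltcR -hB; apply: le_lt_trans (hle _) _.
apply: le_lt_trans xy; exact: (l2_coord (x - y)).
Qed.

Lemma l2_complete (F : set_system l2) : ProperFilter F -> cauchy F -> cvg F.
Proof.
move=> FF /cauchyP Fc.
have cRe := l2_coord_cvg FF Fc cRe_le cReB.
have cIm := l2_coord_cvg FF Fc cIm_le cImB.
pose f n := (lim (complex.Re (x n) @[x --> F]) +i*
             lim (complex.Im (x n) @[x --> F]))%C.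
have fx x (e : R) : 0 < e -> F (ball x e%:C%C) ->
    forall N, \sum_(0 <= k < N) sqmod (f k - x k) <= e ^+ 2.
  move=> e0 Fx N.
  have c : \sum_(0 <= k < N) sqmod (y k - x k) @[y --> F] -->
           \sum_(0 <= k < N) sqmod (f k - x k).
    apply: (@cvg_big _ _ +%R 0 xpredT) => [|k _]; first exact: add_continuous.
    rewrite sqmodE cReB cImB.
    under eq_fun do rewrite sqmodE cReB cImB.
    apply: cvgD; rewrite !expr2; under eq_fun do rewrite !expr2;
      apply: cvgM; apply: cvgB; do ?[exact: cvg_cst | exact: cRe | exact: cIm].
  rewrite -(cvg_lim _ c)//; apply: limr_le; first by apply/cvg_ex; eexists; exact: c.
  suff : F [set y : l2 | \sum_(0 <= k < N) sqmod (y k - x k) <= e ^+ 2] by [].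
  apply: filterS Fx => y; rewrite -ball_normE /= distrC => /ltW.
  by move=> /l2_norm_le-/(_ (ltW e0)) /(_ N).
have f_in : f \in square_summable.
  have [x Fx] := Fc _ (@ltr01 C).
  have h := bounded_square_summable (g := f - (x : nat -> C)) (fx x 1 ltr01 Fx).
  by rewrite -(subrK (x : nat -> C) f) rpredD.
apply/cvg_ex; exists (L2 f_in); apply/cvgrPdist_le => /= e.
case: e => e e'; rewrite ltcE /= => /andP[/eqP -> e0].
have eC : 0 < (e / 2)%:C%C by rewrite ltcR divr_gt0.
have [x Fx] := Fc _ eC; near=> y.
have -> : (e +i* 0)%C = (e / 2)%:C%C + (e / 2)%:C%C.
  by rewrite -[RHS]/((e / 2 + e / 2) +i* (0 + 0))%C addr0 -splitr.
rewrite -(subrKA x).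
apply: le_trans (ler_normD _ _) _; apply: lerD.
  by apply/l2_norm_le; [rewrite ltW// divr_gt0|apply: fx => //; rewrite divr_gt0].
apply: ltW; near: y; apply: filterS Fx => y; by rewrite -ball_normE.
Unshelve. all: by end_near. Qed.

HB.instance Definition _ := Uniform_isComplete.Build l2 l2_complete.
HB.instance Definition _ := NormedModule_hasInner.Build R l2 l2_normE.

Lemma forward_shift_subproof x :
  (fun n => if n is m.+1 then x m else 0) \in square_summable.
Proof.
apply: (@bounded_square_summable _ (limn (series (fun n => sqmod (x n))))).
move=> [|N]; first by have := sqmod_le_sum x 0; rewrite !big_geq.
rewrite big_nat_recl//= sqmodE/= expr0n/= addr0 add0r.
exact: sqmod_le_sum.
Qed.

Definition forward_shift x : l2 := L2 (forward_shift_subproof x).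

Lemma backward_shift_subproof x : (fun n => x n.+1) \in square_summable.
Proof.
apply: (@bounded_square_summable _ (limn (series (fun n => sqmod (x n))))) => N.
apply: le_trans (sqmod_le_sum x N.+1).
by rewrite big_nat_recl//= lerDr sqmod_ge0.
Qed.

Definition backward_shift x : l2 := L2 (backward_shift_subproof x).

End ComplexSeries.

Section Operators.
Variables (R : realType) (H : hilbertType R).
Local Notation C := R[i].
Implicit Types (T S : H -> H) (A : set H) (z w : C).

Definition separable := exists2 D : set H, countable D & dense D.

Definition bounded_operator T := exists M : R, forall x, `|T x| <= M%:C%C * `|x|.

Definition contractive T := forall x, `|T x| <= `|x|.

Definition is_adjoint T S := forall x y, inner (T x) y = inner x (S y).

Definition positive_operator T := forall x, 0 <= inner (T x) x.

(* Adjoints are given through the relation is_adjoint, which determines the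
   adjoint uniquely; on bounded operators it always holds for some S. *)
Definition hyponormal T := exists Ts, is_adjoint T Ts /\
  positive_operator (fun x => Ts (T x) - T (Ts x)).

Definition cohyponormal T := exists Ts, is_adjoint T Ts /\ hyponormal Ts.

Definition linear_span A : set H :=
  [set x | exists n (c : 'I_n -> C) (v : 'I_n -> H),
    (forall i, A (v i)) /\ x = \sum_(i < n) c i *: v i].

Definition orthonormal_basis (e : nat -> H) :=
  (forall m n, inner (e m) (e n) = (m == n)%:R) /\
  closure (linear_span (range e)) = setT.

Definition forward_weighted_shift T :=
  exists (e : nat -> H) (lambda : nat -> C),
    orthonormal_basis e /\ forall n, T (e n) = lambda n *: e n.+1.

Definition backward_weighted_shift T :=
  exists Ts, is_adjoint T Ts /\ forward_weighted_shift Ts.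

Definition unit_disc : set C := [set w | `|w| < 1].

Definition eigen_kernel T w : set H := [set x | T x - w *: x = 0].

Definition one_dimensional A :=
  exists2 v, v != 0 & A = [set c *: v | c in [set: C]].

Definition CowenDouglas_B1 T := [/\ bounded_operator T,
  (forall w, unit_disc w -> one_dimensional (eigen_kernel T w)),
  (forall w, unit_disc w -> closed (range (fun x => T x - w *: x))) &
  closure (linear_span (\bigcup_(w in unit_disc) eigen_kernel T w)) = setT].

(* Derivative at z of F : C -> C along the real line z + t * v, t in R. *)
Definition real_dderive v (F : C -> C) z : C :=
  (derive1 (fun t : R => complex.Re (F (z + t%:C%C * v))) 0 +i*
   derive1 (fun t : R => complex.Im (F (z + t%:C%C * v))) 0)%C.

Definition wirtinger (F : C -> C) z : C :=
  (real_dderive 1 F z - 'i%C * real_dderive 'i%C F z) / 2.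

Definition wirtinger_bar (F : C -> C) z : C :=
  (real_dderive 1 F z + 'i%C * real_dderive 'i%C F z) / 2.

(* The functions gamma allowed in the definition of the curvature at w;
   derivability over C in the direction 1 is complex differentiability. *)
Definition local_holomorphic_section T w (gamma : C -> H) :=
  \forall z \near (w : C^o),
    [/\ gamma z != 0, eigen_kernel T z (gamma z) &
        derivable (gamma : C^o -> H) z 1].

Definition log_norm2 (gamma : C -> H) z : C :=
  (ln (complex.Re (`|gamma z| ^+ 2)))%:C%C.

(* is_curvature T w k means K_T(w) = k; the value does not depend on gamma. *)
Definition is_curvature T w (k : C) :=
  exists2 gamma, local_holomorphic_section T w gamma &
    k = - wirtinger (wirtinger_bar (log_norm2 gamma)) w.

End Operators.

Arguments separable {R} H.

Definition unitarily_equivalent (R : realType) (H K : hilbertType R)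
    (T : H -> H) (S : K -> K) :=
  exists W : {linear H -> K},
    [/\ forall x y, inner (W x) (W y) = inner x y, range W = setT &
        forall x, W (T x) = S (W x)].

Lemma backward_shift_adjoint (R : realType) :
  is_adjoint (@forward_shift R) (@backward_shift R).
Proof.
move=> x y.
change (l2_inner (forward_shift x) y = l2_inner x (backward_shift y)).
by rewrite [LHS]csum_shift// mul0r.
Qed.

(* Main.v *)
(* Let [T e_(n+1) = conj lambda_n e_n]. The kernel condition at 0 forces
   [lambda_n <> 0], contractivity gives [|lambda_n| <= 1], and cohyponormality
   makes [|lambda_n|] nondecreasing; so it suffices to show [|lambda_0| = 1].

   A holomorphic section of eigenvectors has the form [gamma(z) = h(z) k(z)]
   with [h = <gamma, e_0>] holomorphic and without zeros, and
   [|k(z)|^2 = sum_n a_n r^n], [r = |z|^2], [a_n = prod_(k < n) |lambda_k|^-2].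
   As [a_n] is nondecreasing, [|gamma|^2 = |h|^2 g(r) / (1 - r)] where
   [g = sum_n c_n r^n] has coefficients [c_0 = 1], [c_n = a_n - a_(n-1) >= 0].
   The factor [1 / (1 - r)] alone produces the curvature [- (1 - r)^-2] and
   [|h|^2] produces none, so equality at [w0] means that the Laplacian of
   [ln g(|z|^2)] vanishes there, that is [(r g'' + g') g = r g'^2]. With
   [t = g' / g], the left side minus the right side is at least
   [g (r t^2 + c_1 (1 - r t)^2)], hence [c_1 = 0], i.e. [|lambda_0| = 1].

   Since [h] is only known to be complex differentiable near [w0], that [ln |h|^2]
   has second derivatives at all requires Goursat's theorem. *)
Require Import Defs.
From HB Require Import structures.
From mathcomp Require Import all_boot all_order all_algebra.
From mathcomp Require Import all_classical all_reals all_analysis.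
From mathcomp Require Import complex ring lra.

Set Implicit Arguments.
Unset Strict Implicit.
Unset Printing Implicit Defensive.

Import Order.TTheory GRing.Theory Num.Theory.
Import numFieldNormedType.Exports.
Local Open Scope classical_set_scope.
Local Open Scope ring_scope.

(** * Green's formula on rectangles *)

(** The derivatives in [is_curvature] are total: they denote some value even where a function is not
    differentiable, so the curvature equation constrains the weights only once differentiability is
    proved. The first Wirtinger derivative turns ln |h|^2 into the conjugate of h'/h, so the missing
    fact is that h' is complex differentiable at [w0]. Continuity of h' is not given, which is why
    Green's formula is proved under pointwise differentiability. General contours are avoided:
    composing with the exponential turns circles into vertical segments, so rectangles and integrals
    over intervals suffice, and the only Cauchy-type formula needed gives h' at the centre of a
    circle. The constants are generous: real and imaginary parts are estimated separately, each time
    at the cost of a factor 2. *)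

Section Bisection.
Variable R : realType.
Implicit Types (S : R -> R -> R -> R -> Prop) (a b c d : R).

Lemma nested_intervals (a b : nat -> R) :
  (forall n, a n <= a n.+1) -> (forall n, b n.+1 <= b n) ->
  (forall n, a n <= b n) -> exists x, forall n, a n <= x <= b n.
Proof.
move=> aS bS ab.
have aM : {homo a : m n / (m <= n)%N >-> m <= n}.
  by apply: homo_leq => //; exact: le_trans.
have bM : {homo b : m n / (m <= n)%N >-> n <= m}.
  apply: homo_leq => //; first by move=> y x z xy yz; exact: le_trans yz xy.
have ub n : ubound (range a) (b n).
  move=> _ [m _ <-]; apply: le_trans (aM _ _ (leq_maxl m n)) _.
  exact: le_trans (ab _) (bM _ _ (leq_maxr m n)).
exists (sup (range a)) => n; apply/andP; split.
  by apply: ub_le_sup; [exists (b 0%N); exact: ub|exists n].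
by apply: ge_sup; [exists (a 0%N), 0%N|exact: ub].
Qed.

(** Compactness as an induction principle: if [S] failed, some quarter would fail again and again,
    and the nested bad rectangles would shrink to a point where the local hypothesis contradicts
    them. *)
Lemma rectangle_bisection S a b c d : a <= b -> c <= d ->
  (forall a' b' c' d', a <= a' -> a' <= b' -> b' <= b ->
     c <= c' -> c' <= d' -> d' <= d ->
     let m := (a' + b') / 2 in let n := (c' + d') / 2 in
     S a' m c' n -> S m b' c' n -> S a' m n d' -> S m b' n d' ->
     S a' b' c' d') ->
  (forall x y, a <= x <= b -> c <= y <= d -> exists2 e, 0 < e &
     forall a' b' c' d', a <= a' -> a' <= x <= b' -> b' <= b ->
       c <= c' -> c' <= y <= d' -> d' <= d ->
       b' - a' < e -> d' - c' < e -> S a' b' c' d') ->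
  S a b c d.
Proof.
move=> ab cd Ssub Sloc; apply: contrapT => nS.
pose bad (q : R * R * (R * R)) :=
  [/\ ~ S q.1.1 q.1.2 q.2.1 q.2.2,
      [/\ a <= q.1.1, q.1.1 <= q.1.2 & q.1.2 <= b] &
      [/\ c <= q.2.1, q.2.1 <= q.2.2 & q.2.2 <= d]].
pose sub (q q' : R * R * (R * R)) :=
  [/\ q.1.1 <= q'.1.1, q'.1.2 <= q.1.2, q.2.1 <= q'.2.1, q'.2.2 <= q.2.2 &
      q'.1.2 - q'.1.1 = (q.1.2 - q.1.1) / 2 /\
      q'.2.2 - q'.2.1 = (q.2.2 - q.2.1) / 2].
(* The condition [bad q] stays under the existential so that [choice] yields a total function to
   iterate. *)
have step q : exists q', bad q -> bad q' /\ sub q q'.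
  have [[Sq [aq qq qb] [cq qq' qd]]|nb] := pselect (bad q); last by exists q.
  case: q Sq aq qq qb cq qq' qd => -[a' b'] [c' d'] /= Sq aq qq qb cq qq' qd.
  have := Ssub _ _ _ _ aq qq qb cq qq' qd.
  set m := (a' + b') / 2; set n := (c' + d') / 2 => /= Sstep.
  have [am mb] : a' <= m /\ m <= b' by rewrite /m; lra.
  have [cn nd] : c' <= n /\ n <= d' by rewrite /n; lra.
  have [S1|S1] := pselect (S a' m c' n); last first.
    by exists (a', m, (c', n)) => _; split; split => //=;
      split => //=; rewrite /m /n; lra.
  have [S2|S2] := pselect (S m b' c' n); last first.
    by exists (m, b', (c', n)) => _; split; split => //=;
      split => //=; rewrite /m /n; lra.
  have [S3|S3] := pselect (S a' m n d'); last first.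
    by exists (a', m, (n, d')) => _; split; split => //=;
      split => //=; rewrite /m /n; lra.
  have [S4|S4] := pselect (S m b' n d'); last first.
    by exists (m, b', (n, d')) => _; split; split => //=;
      split => //=; rewrite /m /n; lra.
  by case: Sq; exact: Sstep.
have [next nextP] := choice step.
pose q n := iter n next (a, b, (c, d)).
have q_bad n : bad (q n).
  by elim: n => [|n IH]; [|have [] := nextP _ IH].
have q_sub n : sub (q n) (q n.+1) by have [] := nextP _ (q_bad n).
have q_wid n : (q n).1.2 - (q n).1.1 = (b - a) / 2 ^+ n /\
               (q n).2.2 - (q n).2.1 = (d - c) / 2 ^+ n.
  elim: n => [|n [IH1 IH2]]; first by rewrite expr0 !divr1.
  have [_ _ _ _ [-> ->]] := q_sub n.
  by rewrite IH1 IH2 exprSr invfM !mulrA.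
have [x xq] : exists x, forall n, (q n).1.1 <= x <= (q n).1.2.
  by apply: nested_intervals => n; [have [] := q_sub n|have [] := q_sub n|
    have [_ []] := q_bad n].
have [y yq] : exists x, forall n, (q n).2.1 <= x <= (q n).2.2.
  by apply: nested_intervals => n; [have [] := q_sub n|have [] := q_sub n|
    have [_ _ []] := q_bad n].
have [e e0 Se] := Sloc x y (xq 0%N) (yq 0%N).
(* The sum bounds both side lengths, so one number of halvings serves for width and height. *)
pose w := (b - a) + (d - c).
pose n := Num.bound (w / e).
have wn : w / 2 ^+ n < e.
  rewrite ltr_pdivrMr ?exprn_gt0// mulrC -ltr_pdivrMr//.
  exact: upper_nthrootP.
have [nSn [h1 h2 h3] [h4 h5 h6]] := q_bad n.
apply: nSn; have [W1 W2] := q_wid n.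
apply: (Se _ _ _ _ h1 (xq n) h3 h4 (yq n) h6).
  rewrite W1; apply: le_lt_trans wn; rewrite ler_pM2r ?invr_gt0 ?exprn_gt0//.
  by rewrite /w; lra.
rewrite W2; apply: le_lt_trans wn; rewrite ler_pM2r ?invr_gt0 ?exprn_gt0//.
by rewrite /w; lra.
Qed.

End Bisection.

(** * Integrals of continuous functions over compact intervals *)

Section Itg.
Variable R : realType.
Notation mu := (@lebesgue_measure R).
Implicit Types (a b c k M : R) (f g : R -> R).

Definition itg a b f : R := \int[mu]_(x in `[a, b]) f x.

Definition itv_continuous a b f := {within `[a, b], continuous f}.

Lemma itv_integrable a b f : itv_continuous a b f -> mu.-integrable `[a, b] (EFin \o f).
Proof.
by move=> cf; apply: continuous_compact_integrable => //; exact: segment_compact.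
Qed.

Lemma itv_continuousD a b f g : itv_continuous a b f -> itv_continuous a b g ->
  itv_continuous a b (fun x => f x + g x).
Proof.
by move=> cf cg x; apply: (@continuousD R R^o); [exact: cf|exact: cg].
Qed.

Lemma itv_continuousB a b f g : itv_continuous a b f -> itv_continuous a b g ->
  itv_continuous a b (fun x => f x - g x).
Proof.
by move=> cf cg x; apply: (@continuousB R R^o); [exact: cf|exact: cg].
Qed.

Lemma itv_continuousM a b f g : itv_continuous a b f -> itv_continuous a b g ->
  itv_continuous a b (fun x => f x * g x).
Proof.
by move=> cf cg x; apply: (@continuousM R); [exact: cf|exact: cg].
Qed.

Lemma itv_continuous_cst a b k : itv_continuous a b (fun=> k).
Proof. exact/continuous_subspaceT/cst_continuous. Qed.

Lemma itgD a b f g : itv_continuous a b f -> itv_continuous a b g ->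
  itg a b (fun x => f x + g x) = itg a b f + itg a b g.
Proof. by move=> cf cg; rewrite /itg RintegralD//; exact: itv_integrable. Qed.

Lemma itgB a b f g : itv_continuous a b f -> itv_continuous a b g ->
  itg a b (fun x => f x - g x) = itg a b f - itg a b g.
Proof. by move=> cf cg; rewrite /itg RintegralB//; exact: itv_integrable. Qed.

Lemma itgZ a b k f : itv_continuous a b f -> itg a b (fun x => k * f x) = k * itg a b f.
Proof. by move=> cf; rewrite /itg RintegralZl//; exact: itv_integrable. Qed.

Lemma itg_cst a b k : a <= b -> itg a b (fun=> k) = k * (b - a).
Proof.
rewrite le_eqVlt => /predU1P[->|ab].
  by rewrite /itg set_itv1 Rintegral_set1 subrr mulr0.
rewrite /itg Rintegral_cst//; congr (_ * _).
by rewrite [X in fine X]lebesgue_measure_itv/= lte_fin ab.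
Qed.

Lemma itg_itv_split a b c f : a <= c <= b -> itv_continuous a b f ->
  itg a b f = itg a c f + itg c b f.
Proof.
move=> /andP[ac cb] cf; have i := itv_integrable cf.
have := @Rintegral_itvB R f (BLeft a) (BRight b) c i ac cb.
rewrite Rintegral_itv_obnd_cbnd; first by rewrite /itg => <-; rewrite subrKC.
apply: integrableS i => //; apply: subset_itv; rewrite ?bnd_simp//.
Qed.

Lemma itg_approx a b f k M : a <= b -> itv_continuous a b f ->
  (forall x, a <= x <= b -> `|f x - k| <= M) ->
  `|itg a b f - k * (b - a)| <= M * (b - a).
Proof.
move=> ab cf fM.
rewrite -itg_cst// -itgB//; last exact: itv_continuous_cst.
rewrite -itg_cst//.
have cfk : itv_continuous a b (fun x => f x - k).
  by apply: itv_continuousB => //; exact: itv_continuous_cst.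
apply: le_trans (le_normr_Rintegral _ (itv_integrable cfk)) _ => //.
apply: le_Rintegral; [by []| | |].
- by apply: integrable_norm => //; exact: itv_integrable.
- by apply: itv_integrable; exact: itv_continuous_cst.
by move=> x /=; rewrite in_itv/=; exact: fM.
Qed.

End Itg.

Section Green.
Variable R : realType.
Implicit Types (a b c d x y A B D : R) (P Q : R -> R -> R).

Definition linear_approx P x y A B := forall e, 0 < e -> exists2 r, 0 < r &
  forall x' y', `|x' - x| < r -> `|y' - y| < r ->
    `|P x' y' - P x y - (A * (x' - x) + B * (y' - y))| <=
    e * (`|x' - x| + `|y' - y|).

(** Closedness of the 1-form P dx + Q dy at a point: the shared [B] is both the y-derivative of P
    and the x-derivative of Q. *)
Definition closed_at P Q x y := exists A B D,
  linear_approx P x y A B /\ linear_approx Q x y B D.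

Lemma linear_approx_continuous P x y A B : linear_approx P x y A B ->
  forall e, 0 < e -> exists2 r, 0 < r & forall x' y',
    `|x' - x| < r -> `|y' - y| < r -> `|P x' y' - P x y| < e.
Proof.
move=> PAB e e0; have [r r0 rP] := PAB 1 ltr01.
(* With tolerance 1 the increment is at most (1 + |A|) |u| + (1 + |B|) |v|; [K] exceeds the sum of
   the two factors. *)
pose K := 3 + `|A| + `|B|.
have K0 : 0 < K by rewrite /K; have := normr_ge0 A; have := normr_ge0 B; lra.
exists (Num.min r (e / (2 * K))).
  by rewrite lt_min r0/= divr_gt0// mulr_gt0.
move=> x' y'; rewrite !lt_min => /andP[xr xe] /andP[yr ye].
have := rP _ _ xr yr; rewrite mul1r.
move: xe ye; set u := x' - x; set v := y' - y; set Z := P x' y' - P x y.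
rewrite !ltr_pdivlMr ?mulr_gt0// => ue ve Z1.
have : `|Z| <= `|Z - (A * u + B * v)| + (`|A| * `|u| + `|B| * `|v|).
  rewrite -[X in `|X| <= _](subrK (A * u + B * v)) -!normrM.
  by apply: le_trans (ler_normD _ _) _; rewrite lerD2l ler_normD.
have := normr_ge0 A; have := normr_ge0 B; have := normr_ge0 u.
have := normr_ge0 v; move: ue ve Z1; rewrite /K.
move: `|Z - _| `|Z| `|u| `|v| `|A| `|B| => m z p q s t; nra.
Qed.

Lemma linear_approx_contx P x y A B : linear_approx P x y A B ->
  {for x, continuous (fun x => P x y)}.
Proof.
move=> /linear_approx_continuous PAB; apply/cvgrPdist_lt => e e0.
have [r r0 rP] := PAB e e0; exists r => //= x' xx'.
by rewrite distrC; apply: rP; rewrite ?subrr ?normr0// distrC.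
Qed.

Lemma linear_approx_conty P x y A B : linear_approx P x y A B ->
  {for y, continuous (P x)}.
Proof.
move=> /linear_approx_continuous PAB; apply/cvgrPdist_lt => e e0.
have [r r0 rP] := PAB e e0; exists r => //= y' yy'.
by rewrite distrC; apply: rP; rewrite ?subrr ?normr0// distrC.
Qed.

(** Minus the counterclockwise boundary integral of P dx + Q dy. Opposite sides are paired because
    only differences across the rectangle are small to second order. *)
Definition circulation P Q a b c d : R :=
  itg a b (fun x => P x d - P x c) - itg c d (fun y => Q b y - Q a y).

Lemma circulation_splitx P Q a b c d m : a <= m <= b ->
  itv_continuous a b (fun x => P x c) -> itv_continuous a b (fun x => P x d) ->
  itv_continuous c d (Q a) -> itv_continuous c d (Q m) -> itv_continuous c d (Q b) ->
  circulation P Q a b c d = circulation P Q a m c d + circulation P Q m b c d.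
Proof.
move=> mI Pc Pd Qa Qm Qb; rewrite /circulation (itg_itv_split mI); last exact: itv_continuousB.
rewrite addrACA -opprD -itgD; [|exact: itv_continuousB..].
by congr (_ - itg _ _ _); apply/funext => t; ring.
Qed.

Lemma circulation_splity P Q a b c d m : c <= m <= d ->
  itv_continuous a b (fun x => P x c) -> itv_continuous a b (fun x => P x m) ->
  itv_continuous a b (fun x => P x d) -> itv_continuous c d (Q a) -> itv_continuous c d (Q b) ->
  circulation P Q a b c d = circulation P Q a b c m + circulation P Q a b m d.
Proof.
move=> mI Pc Pm Pd Qa Qb; rewrite /circulation.
rewrite (itg_itv_split (a := c) mI); last exact: itv_continuousB.
rewrite addrACA -opprD -itgD; [|exact: itv_continuousB..].
by congr (itg _ _ _ - _); apply/funext => t; ring.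
Qed.

(** The same [k] is used for both pairs of sides, so the two main terms k (b - a) (d - c) cancel and
    only the errors remain. *)
Lemma circulation_bound P Q a b c d k M : a <= b -> c <= d ->
  itv_continuous a b (fun x => P x c) -> itv_continuous a b (fun x => P x d) ->
  itv_continuous c d (Q a) -> itv_continuous c d (Q b) ->
  (forall x, a <= x <= b -> `|P x d - P x c - k * (d - c)| <= M) ->
  (forall y, c <= y <= d -> `|Q b y - Q a y - k * (b - a)| <= M) ->
  `|circulation P Q a b c d| <= M * ((b - a) + (d - c)).
Proof.
move=> ab cd Pc Pd Qa Qb PM QM.
have I1 := itg_approx ab (itv_continuousB Pd Pc) PM.
have I2 := itg_approx cd (itv_continuousB Qb Qa) QM.
rewrite /circulation mulrDr; apply: le_trans (lerD I1 I2).
apply: le_trans (ler_normB _ _); rewrite le_eqVlt; apply/orP; left; apply/eqP.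
by congr `|_|; ring.
Qed.

Let dist_itv (t t' lo hi : R) :
  lo <= t <= hi -> lo <= t' <= hi -> `|t' - t| <= hi - lo.
Proof. by move=> /andP[? ?] /andP[? ?]; rewrite ler_norml; apply/andP; split; lra. Qed.

Lemma linear_approx_rect P x y A B (e : R) : linear_approx P x y A B -> 0 < e ->
  exists2 r, 0 < r & forall a b c d, a <= x <= b -> c <= y <= d ->
    b - a < r -> d - c < r -> forall x' y', a <= x' <= b -> c <= y' <= d ->
    `|P x' y' - P x y - (A * (x' - x) + B * (y' - y))| <= e * ((b - a) + (d - c)).
Proof.
move=> PA e0; have [r r0 rP] := PA e e0; exists r => //.
move=> a b c d xI yI br dr x' y' x'I y'I.
have dx := dist_itv xI x'I; have dy := dist_itv yI y'I.
apply: le_trans (rP x' y' (le_lt_trans dx br) (le_lt_trans dy dr)) _.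
by rewrite ler_pM2l// lerD.
Qed.

Let half_itv (a b : R) : a <= b -> a <= (a + b) / 2 <= b.
Proof. by move=> ab; apply/andP; split; lra. Qed.

Let sub_itv (a b a' b' x : R) : a <= a' -> b' <= b -> a' <= x <= b' -> a <= x <= b.
Proof. by move=> ? ? /andP[? ?]; apply/andP; split; lra. Qed.

(** Each quarter has half the half-perimeter, hence a quarter of its square: this quadratic bound is
    exactly additive under bisection. *)
Let four_quarters (e a b c d S1 S2 S3 S4 : R) :
  let m := (a + b) / 2 in let n := (c + d) / 2 in
  S1 <= e * ((m - a) + (n - c)) ^+ 2 -> S2 <= e * ((b - m) + (n - c)) ^+ 2 ->
  S3 <= e * ((m - a) + (d - n)) ^+ 2 -> S4 <= e * ((b - m) + (d - n)) ^+ 2 ->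
  S1 + S2 + (S3 + S4) <= e * ((b - a) + (d - c)) ^+ 2.
Proof.
move=> m n h1 h2 h3 h4; apply: le_trans (lerD (lerD h1 h2) (lerD h3 h4)) _.
by rewrite le_eqVlt; apply/orP; left; apply/eqP; rewrite /m /n; field.
Qed.

Let two_sides (U V W K e s : R) :
  `|U - W| <= e / 2 * s -> `|V - W - K| <= e / 2 * s -> `|V - U - K| <= e * s.
Proof.
rewrite !ler_norml => /andP[? ?] /andP[? ?].
by apply/andP; split; lra.
Qed.

(* Only differentiability of [P] and [Q] at each point is assumed: bisection
   reduces the claim to the estimate [circulation = o(diameter ^ 2)] at a point. *)
Lemma green P Q a b c d : a <= b -> c <= d ->
  (forall x y, a <= x <= b -> c <= y <= d -> closed_at P Q x y) ->
  circulation P Q a b c d = 0.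
Proof.
move=> ab cd PQ.
have cP y a' b' : c <= y <= d -> a <= a' -> b' <= b -> itv_continuous a' b' (fun x => P x y).
  move=> yI aa bb; apply: continuous_in_subspaceT => x.
  rewrite inE/= in_itv/= => /(sub_itv aa bb) xI.
  by have [A [B [D [/linear_approx_contx + _]]]] := PQ x y xI yI; exact.
have cQ x c' d' : a <= x <= b -> c <= c' -> d' <= d -> itv_continuous c' d' (Q x).
  move=> xI cc dd; apply: continuous_in_subspaceT => y.
  rewrite inE/= in_itv/= => /(sub_itv cc dd) yI.
  by have [A [B [D [_ /linear_approx_conty]]]] := PQ x y xI yI; exact.
pose S e a b c d := `|circulation P Q a b c d| <= e * ((b - a) + (d - c)) ^+ 2.
suff SP e : 0 < e -> S e a b c d.
  apply/eqP; rewrite -normr_le0; apply/ler_addgt0Pl => e e0; rewrite addr0.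
  pose w := ((b - a) + (d - c)) ^+ 2.
  (* [w] itself vanishes for a degenerate rectangle and could not be divided by. *)
  have w1 : 0 < w + 1 by rewrite ltr_wpDl// sqr_ge0.
  have /SP : 0 < e / (w + 1) by rewrite divr_gt0.
  rewrite /S -/w => /le_trans; apply.
  by rewrite -mulrA ler_piMr ?ltW// [ltLHS]mulrC ltr_pdivrMr// mul1r ltrDl.
move=> e0; apply: (rectangle_bisection (S := S e)) => //.
  move=> a' b' c' d' aa ab' bb cc cd' dd m n.
  have mI : a' <= m <= b' := half_itv ab'; have [am mb] := andP mI.
  have nI : c' <= n <= d' := half_itv cd'; have [cn nd] := andP nI.
  have mI' : a <= m <= b := sub_itv aa bb mI.
  have nI' : c <= n <= d := sub_itv cc dd nI.
  have aI' : a <= a' <= b by rewrite aa (le_trans ab').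
  have bI' : a <= b' <= b by rewrite bb (le_trans aa).
  have cI' : c <= c' <= d by rewrite cc (le_trans cd').
  have dI' : c <= d' <= d by rewrite dd (le_trans cc).
  have cn' := le_trans cc cn; have nd' := le_trans nd dd.
  rewrite /S => S1 S2 S3 S4.
  rewrite (circulation_splity nI); [|exact: cP|exact: cP|exact: cP|exact: cQ..].
  rewrite (circulation_splitx mI); [|exact: cP|exact: cP|exact: cQ..].
  rewrite [X in _ + X](circulation_splitx mI);
    [|exact: cP|exact: cP|exact: cQ..].
  apply: le_trans (ler_normD _ _) _.
  apply: le_trans (lerD (ler_normD _ _) (ler_normD _ _)) _.
  exact: four_quarters S1 S2 S3 S4.
move=> x y xI yI; have [A [B [D [PA QA]]]] := PQ x y xI yI.
have e2 : 0 < e / 2 by rewrite divr_gt0.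
have [r1 r10 PA1] := linear_approx_rect PA e2.
have [r2 r20 QA1] := linear_approx_rect QA e2.
exists (Num.min r1 r2); first by rewrite lt_min r10.
move=> a' b' c' d' aa xI' bb cc yI' dd; rewrite !lt_min.
move=> /andP[w1 w2] /andP[h1 h2].
have ab' : a' <= b' by have /andP[/le_trans] := xI'; exact.
have cd' : c' <= d' by have /andP[/le_trans] := yI'; exact.
have PB := PA1 _ _ _ _ xI' yI' w1 h1; have QB := QA1 _ _ _ _ xI' yI' w2 h2.
have aI' : a <= a' <= b by rewrite aa (le_trans ab').
have bI' : a <= b' <= b by rewrite bb (le_trans aa).
have cI' : c <= c' <= d by rewrite cc (le_trans cd').
have dI' : c <= d' <= d by rewrite dd (le_trans cc).
rewrite /S expr2 mulrA.
apply: (circulation_bound (k := B)) => //;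
  [exact: cP|exact: cP|exact: cQ|exact: cQ| |].
  (* [W] is the linear expansion on the lower side; the one on the upper side exceeds it by B (d' -
     c'). The vertical sides below give B (b' - a') with the same [B], because the form is
     closed. *)
  move=> x' x'I; apply: (two_sides (W := P x y + A * (x' - x) + B * (c' - y))).
    have := PB x' c' x'I; rewrite lexx cd' => /(_ isT).
    by congr (`|_| <= _); ring.
  have := PB x' d' x'I; rewrite lexx cd' => /(_ isT).
  by congr (`|_| <= _); ring.
move=> y' y'I; apply: (two_sides (W := Q x y + B * (a' - x) + D * (y' - y))).
  have := QB a' y' _ y'I; rewrite lexx ab' => /(_ isT).
  by congr (`|_| <= _); ring.
have := QB b' y' _ y'I; rewrite lexx ab' => /(_ isT).
by congr (`|_| <= _); ring.
Qed.

End Green.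

(** * Complex derivatives *)

Section Modulus.
Variable R : realType.
Local Notation C := R[i].
Implicit Types (z w : C) (k : R).

(** The norm of R[i] takes values in R[i], which is only partially ordered; a modulus in [R] makes
    real arithmetic and its decision procedures available. *)
Definition cmod z : R := Normc.normc z.

Lemma norm_cmod z : `|z| = (cmod z)%:C%C. Proof. by []. Qed.
Lemma cmod_ge0 z : 0 <= cmod z. Proof. by case: z => a b; exact: sqrtr_ge0. Qed.
Lemma cmodM z w : cmod (z * w) = cmod z * cmod w. Proof. exact: Normc.normcM. Qed.
Lemma cmodD z w : cmod (z + w) <= cmod z + cmod w.
Proof. by rewrite -lecR rmorphD/= -!norm_cmod ler_normD. Qed.
Lemma cmodN z : cmod (- z) = cmod z.
Proof. by apply: complexI; rewrite -!norm_cmod normrN. Qed.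
Lemma cmodV z : cmod z^-1 = (cmod z)^-1. Proof. exact: Normc.normcV. Qed.
Lemma cmod0 : cmod 0 = 0. Proof. exact: Normc.normc0. Qed.
Lemma cmod_eq0 z : (cmod z == 0) = (z == 0).
Proof. by apply/eqP/eqP => [/Normc.eq0_normc//|->]; exact: cmod0. Qed.
Lemma cmod_gt0 z : (0 < cmod z) = (z != 0).
Proof. by rewrite lt_def cmod_eq0 cmod_ge0 andbT. Qed.
Lemma cmodR k : cmod k%:C%C = `|k|.
Proof. by rewrite /cmod/= expr0n/= addr0 sqrtr_sqr. Qed.
Lemma sqr_cmod z : cmod z ^+ 2 = complex.Re z ^+ 2 + complex.Im z ^+ 2.
Proof. by case: z => a b; rewrite sqr_sqrtr ?addr_ge0 ?sqr_ge0. Qed.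

Lemma Re_le_cmod z : `|complex.Re z| <= cmod z.
Proof.
rewrite -ler_sqr ?nnegrE ?cmod_ge0// sqr_cmod real_normK ?num_real//.
by rewrite lerDl sqr_ge0.
Qed.

Lemma Im_le_cmod z : `|complex.Im z| <= cmod z.
Proof.
rewrite -ler_sqr ?nnegrE ?cmod_ge0// sqr_cmod real_normK ?num_real//.
by rewrite lerDr sqr_ge0.
Qed.

Lemma cmod_le_ReIm z : cmod z <= `|complex.Re z| + `|complex.Im z|.
Proof.
rewrite -ler_sqr ?nnegrE ?cmod_ge0 ?addr_ge0// sqr_cmod sqrrD !real_normK ?num_real//.
by rewrite addrAC lerDl mulrn_wge0// mulr_ge0.
Qed.

Lemma ltc_real (e : C) : 0 < e -> exists2 k, 0 < k & e = k%:C%C.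
Proof.
by case: e => a b; rewrite ltcE/= => /andP[/eqP -> a0]; exists a.
Qed.

End Modulus.
Arguments cmod : simpl never.

Lemma cvg_is_derive (K : numFieldType) (V W : normedModType K) (f : V -> W)
    (a v : V) (d : W) :
  h^-1 *: ((f \o shift a) (h *: v) - f a) @[h --> (0 : K)^'] --> d ->
  is_derive a v f d.
Proof.
move=> cv; apply: DeriveDef; first by apply/cvg_ex; exists d.
exact: cvg_lim cv.
Qed.

Section ComplexDerivative.
Variable R : realType.
Local Notation C := R[i].
Implicit Types (z w d : C) (f g : C -> C).

Lemma cvg_cmodP (T : Type) (F : set_system T) (FF : Filter F) (f : T -> C^o) d :
  f @ F --> (d : C^o) <->
  forall e : R, 0 < e -> \forall t \near F, cmod (d - f t) < e.
Proof.
have [H1 H2] := @cvgrPdist_lt C C^o T F FF f d; split=> [/H1 H e e0|H].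
  have e0' : 0 < e%:C%C by rewrite ltcR.
  by apply: filterS (H _ e0') => t; rewrite norm_cmod ltcR.
apply: H2 => _ /ltc_real[e e0 ->]; apply: filterS (H e e0) => t.
by rewrite norm_cmod ltcR.
Qed.

(** Clearing the denominator includes u = 0 and leaves real radii and tolerances; the estimates
    below use this form. *)
Lemma is_derive_linear_approx z f d : is_derive (z : C^o) 1 (f : C^o -> C^o) d <->
  forall e : R, 0 < e -> exists2 r : R, 0 < r &
    forall u, cmod u < r -> cmod (f (z + u) - f z - d * u) <= e * cmod u.
Proof.
have E u : u != 0 ->
    cmod (d - u^-1 *: (f (u *: 1 + z) - f z)) * cmod u = cmod (f (z + u) - f z - d * u).
  move=> u0; rewrite -cmodM -cmodN; congr cmod.
  rewrite -[u^-1 *: _]/(u^-1 * _) -[u *: 1]/(u * 1) mulr1 mulrBl opprB.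
  by rewrite mulrAC mulVf// mul1r [u + z]addrC.
split=> [[df dE] e e0|H].
  have : (fun h : C^o => h^-1 *: ((f \o shift z) (h *: 1) - f z)) @ (0 : C^o)^' --> (d : C^o).
    by rewrite -dE; exact: df.
  move=> /cvg_cmodP /(_ e e0)[r /= /ltc_real[k k0 ->] rP]; exists k => // u uk.
  have [->|u0] := eqVneq u 0.
    by rewrite addr0 mulr0 !subr0 subrr cmod0 mulr0.
  rewrite -E// ler_wpM2r ?cmod_ge0// ltW//.
  by apply: rP => //=; rewrite sub0r normrN norm_cmod ltcR.
have cv : (fun h : C^o => h^-1 *: ((f \o shift z) (h *: 1) - f z)) @ (0 : C^o)^' --> (d : C^o).
  apply/cvg_cmodP => e e0.
  have e20 : 0 < e / 2 by rewrite divr_gt0.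
  have [r r0 rP] := H _ e20.
  exists r%:C%C; first by rewrite /= ltcR.
  move=> u /=; rewrite sub0r normrN norm_cmod ltcR => ur u0.
  apply: (@le_lt_trans _ _ (e / 2)); last first.
    by rewrite ltr_pdivrMr// ltr_pMr// ltr1n.
  by rewrite -(ler_pM2r (x := cmod u)) ?cmod_gt0// E//; exact: rP.
exact: (@cvg_is_derive C C^o C^o).
Qed.

Lemma is_derive_chain (K : numFieldType) (f g : K -> K^o) (x df dg : K) :
  is_derive x 1 g dg -> is_derive (g x) 1 f df ->
  is_derive x 1 (f \o g) (df * dg).
Proof.
move=> [dg1 dgE] [df1 dfE].
have Dg : differentiable g x by exact/derivable1_diffP.
have Df : differentiable f (g x) by exact/derivable1_diffP.
have Dfg : differentiable (f \o g) x by exact: differentiable_comp.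
apply: DeriveDef; first exact/derivable1_diffP.
rewrite deriveE// diff_comp//= -[X in 'd f _ X]deriveE// dgE deriv1E//.
by rewrite derive1E dfE mulrC.
Qed.

End ComplexDerivative.

(** * Goursat's theorem in exponential coordinates *)

Lemma is_derive_real_approx (R : realType) (f : R -> R) (x d : R) :
  is_derive x 1 f d -> forall e : R, 0 < e -> exists2 r : R, 0 < r &
    forall u, `|u| < r -> `|f (x + u) - f x - d * u| <= e * `|u|.
Proof.
move=> [df dE] e e0.
have : h^-1 *: ((f \o shift x) (h *: 1) - f x) @[h --> (0 : R)^'] --> d.
  by rewrite -dE; exact: df.
move=> /cvgrPdist_lt /(_ e e0)[r /= r0 rP]; exists r => // u ur.
have [->|u0] := eqVneq u 0; first by rewrite addr0 mulr0 subr0 subrr normr0 mulr0.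
have := rP u; rewrite /= sub0r normrN => /(_ ur u0)/ltW.
rewrite -[u^-1 *: _]/(u^-1 * _) -[u *: 1]/(u * 1) mulr1.
rewrite -(ler_pM2r (x := `|u|)) ?normr_gt0// -normrM mulrBl.
by rewrite mulrAC mulVf// mul1r [u + x]addrC distrC.
Qed.

(** * The complex exponential and its derivative *)

Section ComplexExp.
Variable R : realType.
Local Notation C := R[i].
Implicit Types (z w : C).

Definition cexp z : C := ((expR (complex.Re z) * cos (complex.Im z)) +i*
                          (expR (complex.Re z) * sin (complex.Im z)))%C.

Lemma cexpD z w : cexp (z + w) = cexp z * cexp w.
Proof.
case: z w => [a b] [c d]; apply/eqP; rewrite eq_complex /= expRD cosD sinD.
by apply/andP; split; apply/eqP; ring.
Qed.

Lemma cmod_cexp z : cmod (cexp z) = expR (complex.Re z).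
Proof.
apply/eqP; rewrite -(eqrXn2 (n := 2))// ?cmod_ge0 ?expR_ge0//.
by rewrite sqr_cmod/= !exprMn -mulrDr cos2Dsin2 mulr1.
Qed.

Lemma cexp_neq0 z : cexp z != 0.
Proof. by rewrite -cmod_gt0 cmod_cexp expR_gt0. Qed.

Lemma cexp_periodic (x : R) : cexp (x +i* (2 * pi))%C = cexp (x +i* 0)%C.
Proof.
by rewrite /cexp/= mulr_natl cos2pi sin2pi cos0 sin0.
Qed.

Lemma is_derive_cexp z : is_derive (z : C^o) 1 (cexp : C^o -> C^o) (cexp z).
Proof.
(* By [cexpD] the remainder at z is [cexp z] times the remainder at 0. *)
suff H0 : forall e : R, 0 < e -> exists2 r : R, 0 < r &
    forall u, cmod u < r -> cmod (cexp u - 1 - u) <= e * cmod u.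
  apply/is_derive_linear_approx => e e0.
  have [|r r0 rP] := H0 (e / expR (complex.Re z)); first by rewrite divr_gt0 ?expR_gt0.
  exists r => // u ur.
  have -> : cexp (z + u) - cexp z - cexp z * u = cexp z * (cexp u - 1 - u).
    by rewrite cexpD !mulrBr mulr1.
  rewrite cmodM cmod_cexp -ler_pdivlMl ?expR_gt0// mulrA [_^-1 * e]mulrC.
  exact: rP.
(* The four error terms below add up to (1 + 3 + 3 + 2) e' m, less than 10 e' m for m > 0; the bound
   e' <= 1 keeps |x| <= 1 and the exponential at most 3. *)
move=> e e0; have [e' e'0 [e'1 e'e]] : exists2 e', 0 < e' & e' <= 1 /\ e' <= e / 10.
  exists (Num.min (e / 10) 1); first by rewrite lt_min; apply/andP; split; lra.
  by rewrite !ge_min !lexx orbT.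
have [r1 r10 H1] := is_derive_real_approx (is_derive_expR (0 : R)) e'0.
have [r2 r20 H2] := is_derive_real_approx (is_derive_cos (0 : R)) e'0.
have [r3 r30 H3] := is_derive_real_approx (is_derive_sin (0 : R)) e'0.
exists (Num.min (Num.min r1 r2) (Num.min r3 e')).
  by rewrite !lt_min r10 r20 r30.
case=> x y; rewrite !lt_min => /andP[/andP[u1 u2] /andP[u3 u4]].
have xm := Re_le_cmod (x +i* y)%C; have ym := Im_le_cmod (x +i* y)%C.
rewrite /= in xm ym.
have := H1 x (le_lt_trans xm u1); have := H2 y (le_lt_trans ym u2).
have := H3 y (le_lt_trans ym u3).
rewrite !add0r expR0 sin0 cos0 oppr0 mul0r !mul1r !subr0 !addr0 => s3 s2 s1.
apply: le_trans (cmod_le_ReIm _) _ => /=.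
move: u4; set m := cmod _ in xm ym *; move=> u4.
rewrite subr0.
set E := expR x in s1 *; set co := cos y in s2 *; set si := sin y in s3 *.
have X1 : `|x| <= 1 by lra.
have E3 : `|E| <= 3.
  have := ler_normD 1 x; rewrite normr1 => a1.
  have -> : E = E - 1 - x + (1 + x) by ring.
  apply: le_trans (ler_normD _ _) _.
  have : e' * `|x| <= 1 by rewrite mulr_ile1 ?(ltW e'0).
  lra.
have E1 : `|E - 1| <= 2 * `|x|.
  have -> : E - 1 = (E - 1 - x) + x by ring.
  apply: le_trans (ler_normD _ _) _.
  have := normr_ge0 x; nra.
have -> : E * co - 1 - x = (E - 1 - x) + E * (co - 1) by ring.
have -> : E * si - y = E * (si - y) + (E - 1) * y by ring.
apply: le_trans (lerD (ler_normD _ _) (ler_normD _ _)) _.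
rewrite !normrM.
have m0 : 0 <= m by exact: cmod_ge0.
have t1 : e' * `|x| <= e' * m by rewrite ler_pM2l.
have t2 : `|E| * `|co - 1| <= 3 * (e' * m).
  apply: ler_pM => //; apply: le_trans s2 _; by rewrite ler_pM2l.
have t3 : `|E| * `|si - y| <= 3 * (e' * m).
  apply: ler_pM => //; apply: le_trans s3 _; by rewrite ler_pM2l.
have t4 : `|E - 1| * `|y| <= 2 * (e' * m).
  rewrite mulrA; apply: ler_pM => //; apply: le_trans E1 _.
  by rewrite ler_pM2l//; lra.
have t5 : e' * m <= e / 10 * m by rewrite ler_wpM2r.
have t6 : 0 <= e * m by rewrite mulr_ge0// ltW.
lra.
Qed.

End ComplexExp.

Section Goursat.
Variable R : realType.
Local Notation C := R[i].
Implicit Types (F : C -> C).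

(** The Cauchy-Riemann equations: both gradients are read off from the one complex derivative A +
    iB. *)
Lemma derivable_linear_approx F (x y : R) :
  derivable (F : C^o -> C^o) ((x +i* y)%C : C^o) 1 -> exists A B,
  linear_approx (fun x y => complex.Re (F (x +i* y)%C)) x y A (- B) /\
  linear_approx (fun x y => complex.Im (F (x +i* y)%C)) x y B A.
Proof.
move=> /derivableP; set z := (x +i* y)%C.
set d : C := ('D_1 (F : C^o -> C^o) (z : C^o)) => dF.
exists (complex.Re d), (complex.Im d).
have H (e : R) : 0 < e -> exists2 r : R, 0 < r & forall x' y' : R,
    `|x' - x| < r -> `|y' - y| < r ->
    cmod (F (x' +i* y')%C - F z - d * ((x' - x) +i* (y' - y))%C) <=
      e * (`|x' - x| + `|y' - y|).
  move=> e0; have [r r0 rP] := (is_derive_linear_approx z F d).1 dF e e0.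
  exists (r / 2); first by rewrite divr_gt0.
  move=> x' y' xr yr; have := cmod_le_ReIm ((x' - x) +i* (y' - y))%C => /= mm.
  have := rP ((x' - x) +i* (y' - y))%C.
  have -> : z + ((x' - x) +i* (y' - y))%C = (x' +i* y')%C.
    by apply/eqP; rewrite eq_complex /= !subrKC !eqxx.
  move=> /(_ _)/le_trans; apply; first by apply: le_lt_trans mm _; lra.
  by rewrite ler_pM2l.
split=> e e0; have [r r0 rP] := H e e0; exists r => // x' y' xr yr;
  apply: le_trans (rP _ _ xr yr).
- apply: le_trans (Re_le_cmod _); rewrite !(cReB, cReM) /=.
  by rewrite mulNr.
- apply: le_trans (Im_le_cmod _); rewrite !(cImB, cImM) /=.
  by rewrite [X in _ - X]addrC.
Qed.

(** The real and imaginary parts of F dz are the forms Re F dx - Im F dy and Im F dx + Re F dy,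
    closed by the Cauchy-Riemann equations. The horizontal sides stand alone on the left so that
    periodicity can make them vanish. *)
Lemma goursat F a b c d : a <= b -> c <= d ->
  (forall x y, a <= x <= b -> c <= y <= d ->
     derivable (F : C^o -> C^o) ((x +i* y)%C : C^o) 1) ->
  itg a b (fun x => complex.Re (F (x +i* d)%C) - complex.Re (F (x +i* c)%C)) =
  itg c d (fun y => complex.Im (F (a +i* y)%C) - complex.Im (F (b +i* y)%C)) /\
  itg a b (fun x => complex.Im (F (x +i* d)%C) - complex.Im (F (x +i* c)%C)) =
  itg c d (fun y => complex.Re (F (b +i* y)%C) - complex.Re (F (a +i* y)%C)).
Proof.
move=> ab cd dF; split; apply/eqP; rewrite -subr_eq0; apply/eqP.
  have -> : (fun y => complex.Im (F (a +i* y)%C) - complex.Im (F (b +i* y)%C)) =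
      (fun y => - complex.Im (F (b +i* y)%C) - - complex.Im (F (a +i* y)%C)).
    by apply/funext => y; rewrite opprK addrC.
  apply: (@green R (fun x y => complex.Re (F (x +i* y)%C))
    (fun x y => - complex.Im (F (x +i* y)%C)) a b c d ab cd).
  move=> x y xI yI; have [A [B [H1 H2]]] := derivable_linear_approx (dF x y xI yI).
  exists A, (- B), (- A); split=> // e e0; have [r r0 rP] := H2 e e0.
  exists r => // x' y' xr yr; rewrite -normrN; apply: le_trans (rP x' y' xr yr).
  by rewrite le_eqVlt; apply/orP; left; apply/eqP; congr `|_|; ring.
apply: (@green R (fun x y => complex.Im (F (x +i* y)%C))
  (fun x y => complex.Re (F (x +i* y)%C)) a b c d ab cd).
move=> x y xI yI; have [A [B [H1 H2]]] := derivable_linear_approx (dF x y xI yI).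
by exists B, A, (- B).
Qed.

End Goursat.

Lemma real_approx_is_derive (R : realType) (f : R -> R) (x d : R) :
  (forall e : R, 0 < e -> exists2 r : R, 0 < r &
    forall u, `|u| < r -> `|f (x + u) - f x - d * u| <= e * `|u|) ->
  is_derive x 1 f d.
Proof.
move=> H; apply: cvg_is_derive; apply/cvgrPdist_le => e e0.
have [r r0 rP] := H e e0; exists r => // u /=.
rewrite sub0r normrN => ur u0.
rewrite -[u^-1 *: _]/(u^-1 * _) -[u *: 1]/(u * 1) mulr1.
rewrite -(ler_pM2r (x := `|u|)) ?normr_gt0// -normrM mulrBl mulrAC mulVf// mul1r.
by rewrite [u + x]addrC distrC; exact: rP.
Qed.

Section Line.
Variable R : realType.
Local Notation C := R[i].
Implicit Types (F : C -> C) (z v d : C).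

Lemma is_derive_line F z v d (t : R) :
  is_derive (z + t%:C%C * v : C^o) 1 (F : C^o -> C^o) d ->
  is_derive t 1 (fun s : R => complex.Re (F (z + s%:C%C * v))) (complex.Re (d * v)) /\
  is_derive t 1 (fun s : R => complex.Im (F (z + s%:C%C * v))) (complex.Im (d * v)).
Proof.
move=> /is_derive_linear_approx dF.
have H (e : R) : 0 < e -> exists2 r : R, 0 < r & forall u : R, `|u| < r ->
    cmod (F (z + (t + u)%:C%C * v) - F (z + t%:C%C * v) - d * v * u%:C%C) <= e * `|u|.
  move=> e0; have K0 : 0 < cmod v + 1 by have := cmod_ge0 v; lra.
  have [r r0 rP] := dF (e / (cmod v + 1)) (divr_gt0 e0 K0).
  exists (r / (cmod v + 1)); first exact: divr_gt0.
  move=> u; rewrite ltr_pdivlMr// => ur.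
  have mdu : cmod (u%:C%C * v) = `|u| * cmod v by rewrite cmodM cmodR.
  have le1 : `|u| * cmod v <= `|u| * (cmod v + 1) by rewrite ler_wpM2l// lerDl.
  have := rP (u%:C%C * v); rewrite mdu => /(_ (le_lt_trans le1 ur)).
  rewrite rmorphD/= mulrDl addrA [u%:C%C * v]mulrC [d * (v * _)]mulrA => /le_trans; apply.
  rewrite -mulrA ler_pM2l// mulrC ler_pdivrMr//.
split; apply: real_approx_is_derive => e e0; have [r r0 rP] := H e e0;
    exists r => // u ur; apply: le_trans (rP u ur).
  have -> : complex.Re (d * v) * u = complex.Re (d * v * u%:C%C).
    by rewrite [RHS]cReM/= mulr0 subr0.
  by rewrite -!cReB; exact: Re_le_cmod.
have -> : complex.Im (d * v) * u = complex.Im (d * v * u%:C%C).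
  by rewrite [RHS]cImM/= mulr0 add0r.
by rewrite -!cImB; exact: Im_le_cmod.
Qed.

(** The mean value theorem is real, so it is applied to the real and imaginary parts with separate
    intermediate points; hence the factor 2. *)
Lemma mean_value_bound F z v (M : R) :
  (forall t : R, 0 <= t <= 1 ->
    derivable (F : C^o -> C^o) (z + t%:C%C * v : C^o) 1 /\
    cmod ('D_1 (F : C^o -> C^o) (z + t%:C%C * v : C^o)) <= M) ->
  cmod (F (z + v) - F z) <= 2 * M * cmod v.
Proof.
move=> H.
have D t : 0 <= t <= 1 -> _ := fun tI => is_derive_line (derivableP (H t tI).1).
have E (p : C -> R) : (forall w, `|p w| <= cmod w) -> (forall w w', p (w - w') = p w - p w') ->
   (forall t : R, 0 <= t <= 1 -> is_derive t 1 (fun s : R => p (F (z + s%:C%C * v)))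
     (p ('D_1 (F : C^o -> C^o) (z + t%:C%C * v : C^o) * v))) ->
   `|p (F (z + v) - F z)| <= M * cmod v.
  move=> pm pB pD; have [] := @MVT_segment R (fun s : R => p (F (z + s%:C%C * v)))
    (fun t : R => p ('D_1 (F : C^o -> C^o) (z + t%:C%C * v : C^o) * v)) 0 1 ler01.
  - by move=> t; rewrite in_itv/= => /andP[/ltW t0 /ltW t1]; apply: pD; rewrite t0.
  - apply: derivable_within_continuous => t; rewrite in_itv/= => tI.
    by have [] := pD t tI.
  move=> c; rewrite in_itv/= => cI.
  rewrite mul1r mul0r addr0 subr0 mulr1 pB => ->.
  apply: le_trans (pm _) _; rewrite cmodM ler_wpM2r ?cmod_ge0//.
  by have [] := H c cI.
apply: le_trans (cmod_le_ReIm _) _; rewrite -mulrA mulr_natl mulr2n.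
by apply: lerD; apply: E => //; do ?[exact: Re_le_cmod | exact: Im_le_cmod |
  exact: cReB | exact: cImB | by move=> t /D[]].
Qed.

Lemma derivable_cmod_continuous F z : derivable (F : C^o -> C^o) (z : C^o) 1 ->
  forall e : R, 0 < e -> exists2 r : R, 0 < r &
    forall u, cmod u < r -> cmod (F (z + u) - F z) < e.
Proof.
move=> /derivableP; set d : C := ('D_1 (F : C^o -> C^o) (z : C^o)).
move=> /is_derive_linear_approx /(_ 1 ltr01)[r r0 rP] e e0.
have K0 : 0 < cmod d + 1 by have := cmod_ge0 d; lra.
exists (Num.min r (e / (cmod d + 1))); first by rewrite lt_min r0 divr_gt0.
move=> u; rewrite lt_min ltr_pdivlMr// => /andP[/rP ru ue].
rewrite -(subrK (d * u) (_ - _)); apply: le_lt_trans (cmodD _ _) _.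
rewrite cmodM; apply: le_lt_trans ue.
by rewrite mulrDr mulr1 addrC [cmod d * _]mulrC lerD2l -[leRHS]mul1r.
Qed.

End Line.

(** * Circle integrals in a logarithmic coordinate *)

Section CircleIntegral.
Variable R : realType.
Local Notation C := R[i].
Implicit Types (f g : R -> C) (h : C -> C) (k z : C).

Definition cint f : C :=
  (itg 0 (2 * pi) (fun y => complex.Re (f y)) +i*
   itg 0 (2 * pi) (fun y => complex.Im (f y)))%C.

Definition ccont f :=
  itv_continuous 0 (2 * pi) (fun y => complex.Re (f y)) /\
  itv_continuous 0 (2 * pi) (fun y => complex.Im (f y)).

Lemma ccont_cmod f :
  (forall (y e : R), 0 < e -> exists2 r : R, 0 < r &
     forall y', `|y' - y| < r -> cmod (f y' - f y) < e) -> ccont f.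
Proof.
move=> H; split; apply: continuous_subspaceT => y; apply/cvgrPdist_lt => e e0;
  have [r r0 rP] := H y e e0; exists r => // y' /=; rewrite distrC => yr;
  rewrite distrC; apply: le_lt_trans (rP y' yr).
- by rewrite -cReB; exact: Re_le_cmod.
- by rewrite -cImB; exact: Im_le_cmod.
Qed.

Lemma ccont_cst k : ccont (fun=> k).
Proof. by split; exact: itv_continuous_cst. Qed.

Lemma ccontB f g : ccont f -> ccont g -> ccont (fun y => f y - g y).
Proof.
move=> [f1 f2] [g1 g2]; split.
  rewrite (_ : (fun y => _) = (fun y => complex.Re (f y) - complex.Re (g y))).
    exact: itv_continuousB.
  by apply/funext => y; rewrite cReB.
rewrite (_ : (fun y => _) = (fun y => complex.Im (f y) - complex.Im (g y))).
  exact: itv_continuousB.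
by apply/funext => y; rewrite cImB.
Qed.

Lemma ccontM f g : ccont f -> ccont g -> ccont (fun y => f y * g y).
Proof.
move=> [f1 f2] [g1 g2]; split.
  rewrite (_ : (fun y => _) = (fun y =>
    complex.Re (f y) * complex.Re (g y) - complex.Im (f y) * complex.Im (g y))).
    by apply: itv_continuousB; exact: itv_continuousM.
  by apply/funext => y; rewrite cReM.
rewrite (_ : (fun y => _) = (fun y =>
  complex.Re (f y) * complex.Im (g y) + complex.Im (f y) * complex.Re (g y))).
  by apply: itv_continuousD; exact: itv_continuousM.
by apply/funext => y; rewrite cImM.
Qed.

Lemma cintB f g : ccont f -> ccont g ->
  cint (fun y => f y - g y) = cint f - cint g.
Proof.
move=> [f1 f2] [g1 g2]; rewrite /cint.
  rewrite (_ : (fun y => complex.Re (f y - g y)) =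
      (fun y => complex.Re (f y) - complex.Re (g y))); last first.
    by apply/funext => y; rewrite cReB.
  rewrite (_ : (fun y => complex.Im (f y - g y)) =
      (fun y => complex.Im (f y) - complex.Im (g y))); last first.
    by apply/funext => y; rewrite cImB.
by rewrite !itgB.
Qed.

Lemma cintZ k f : ccont f -> cint (fun y => k * f y) = k * cint f.
Proof.
move=> [f1 f2]; rewrite /cint.
rewrite (_ : (fun y => complex.Re (k * f y)) = (fun y =>
    complex.Re k * complex.Re (f y) - complex.Im k * complex.Im (f y)));
  last by apply/funext => y; rewrite cReM.
rewrite (_ : (fun y => complex.Im (k * f y)) = (fun y =>
    complex.Re k * complex.Im (f y) + complex.Im k * complex.Re (f y)));
  last by apply/funext => y; rewrite cImM.
have cZ a p : itv_continuous 0 (2 * pi) p -> itv_continuous 0 (2 * pi) (fun y => a * p y).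
  by apply: itv_continuousM; exact: itv_continuous_cst.
rewrite itgB ?itgD ?itgZ//; do ?exact: cZ.
by case: k => a b.
Qed.

Lemma cint_approx f k (M : R) : ccont f ->
  (forall y, 0 <= y <= 2 * pi -> cmod (f y - k) <= M) ->
  cmod (cint f - (2 * pi)%:C%C * k) <= 2 * M * (2 * pi).
Proof.
move=> [f1 f2] fM; have pi0 : 0 <= 2 * pi :> R by rewrite mulr_ge0// pi_ge0.
apply: le_trans (cmod_le_ReIm _) _; rewrite cReB cImB cReM cImM /= mul0r subr0.
rewrite mul0r addr0.
have E (p : R) : 2 * pi * p = p * (2 * pi - 0) by rewrite subr0 mulrC.
have -> : 2 * M * (2 * pi) = M * (2 * pi - 0) + M * (2 * pi - 0) by ring.
rewrite !E; apply: lerD; apply: itg_approx => // y yI;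
  apply: le_trans (fM y yI).
- by rewrite -cReB; exact: Re_le_cmod.
- by rewrite -cImB; exact: Im_le_cmod.
Qed.

Lemma cint_bound f (M : R) : ccont f ->
  (forall y, 0 <= y <= 2 * pi -> cmod (f y) <= M) -> cmod (cint f) <= 2 * M * (2 * pi).
Proof.
move=> cf fM; have := @cint_approx f 0 M cf.
by rewrite mulr0 subr0; apply=> y yI; rewrite subr0; exact: fM.
Qed.


(** Polar coordinates written through [cexp], so that continuity along the circle and comparison of
    radii come from complex differentiability in the exponent. *)
Definition circ (r y : R) : C := cexp (ln r +i* y)%C.

Lemma cmod_circ r y : 0 < r -> cmod (circ r y) = r.
Proof. by move=> r0; rewrite cmod_cexp/= lnK. Qed.

Lemma cmod_line (F : C -> C) (s : R) :
  (forall y, derivable (F : C^o -> C^o) ((s +i* y)%C : C^o) 1) ->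
  forall (y e : R), 0 < e -> exists2 r : R, 0 < r &
     forall y', `|y' - y| < r -> cmod (F (s +i* y')%C - F (s +i* y)%C) < e.
Proof.
move=> dF y e e0; have [r r0 rP] := derivable_cmod_continuous (dF y) e0.
exists r => // y' yr; have := rP (0 +i* (y' - y))%C.
rewrite [(_ +i* _)%C + _](_ : _ = (s +i* y')%C); last first.
  by apply/eqP; rewrite eq_complex/= addr0 subrKC !eqxx.
by apply; apply: le_lt_trans (cmod_le_ReIm _) _; rewrite /= normr0 add0r.
Qed.

Lemma circ_continuous r (y e : R) : 0 < e -> exists2 t : R, 0 < t &
  forall y', `|y' - y| < t -> cmod (circ r y' - circ r y) < e.
Proof.
by apply: cmod_line => {}y; have [] := is_derive_cexp (ln r +i* y)%C.
Qed.

Lemma ccont_circV r : ccont (fun y => (circ r y)^-1).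
Proof.
apply: ccont_cmod; apply: (cmod_line (F := fun z => (cexp z)^-1)) => y.
apply: (@derivableV C C^o); first exact: cexp_neq0.
by have [] := is_derive_cexp (ln r +i* y)%C.
Qed.

(* In the coordinate [x] with [zeta = exp x] the circle of radius [r] is the
   vertical segment [Re x = ln r]. Goursat's theorem on a rectangle of height
   [2 pi], whose horizontal sides cancel by periodicity, shows that the integral
   does not depend on [r]; it tends to [2 pi h'(z)] as [r] tends to 0. *)
Lemma circle_difference_quotient h z (r : R) : 0 < r ->
  (forall u, cmod u <= r -> derivable (h : C^o -> C^o) (z + u : C^o) 1) ->
  ccont (fun y => (h (z + circ r y) - h z) / circ r y) /\
  cint (fun y => (h (z + circ r y) - h z) / circ r y) =
    (2 * pi)%:C%C * 'D_1 (h : C^o -> C^o) (z : C^o).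
Proof.
(* As [cexp x] never vanishes, [K] has no singularity: the centre of the circle lies at infinity on
   the left. *)
move=> r0 dh; pose K x := (h (z + cexp x) - h z) / cexp x.
have dK x : complex.Re x <= ln r -> derivable (K : C^o -> C^o) (x : C^o) 1.
  move=> xr; have [de _] := is_derive_cexp x.
  apply: (@derivableM C C^o); last first.
    by apply: (@derivableV C C^o) => //; exact: cexp_neq0.
  apply: derivableB; last exact: derivable_cst.
  have d1 : is_derive (x : C^o) 1 (fun x : C^o => z + cexp x : C^o) (0 + cexp x).
    apply: (@is_deriveD C C^o C^o (cst z) (@cexp R)); last exact: is_derive_cexp.
  have d2 : is_derive (z + cexp x : C^o) 1 (h : C^o -> C^o)
      ('D_1 (h : C^o -> C^o) (z + cexp x : C^o)).
    apply/derivableP/dh; rewrite cmod_cexp.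
    by apply: le_trans (_ : expR (ln r) <= _); [rewrite ler_expR|rewrite lnK].
  by have [] := is_derive_chain d1 d2.
have cK s : s <= ln r -> ccont (fun y => K (s +i* y)%C).
  by move=> sr; apply/ccont_cmod/cmod_line => y; exact: dK.
split; first exact: cK.
have pi0 : 0 <= 2 * pi :> R by rewrite mulr_ge0// pi_ge0.
have const s : s <= ln r -> cint (fun y => K (ln r +i* y)%C) = cint (fun y => K (s +i* y)%C).
  move=> sr; have [|G1 G2] := @goursat R K s (ln r) 0 (2 * pi) sr pi0.
    by move=> x y /andP[_ xr] _; exact: dK.
  have KE x : K (x +i* (2 * pi))%C = K (x +i* 0)%C by rewrite /K cexp_periodic.
  have K0 (p : C -> R) :
      (fun x => p (K (x +i* (2 * pi))%C) - p (K (x +i* 0)%C)) = (fun=> 0).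
    by apply/funext => x; rewrite KE subrr.
  move: G1 G2; rewrite (K0 (@complex.Re R)) (K0 (@complex.Im R)).
  have [c1 c2] := cK _ sr; have [c3 c4] := cK _ (lexx (ln r)).
  rewrite (itg_cst 0 sr) mul0r (itgB c2 c4) (itgB c3 c1) => G1 G2.
  by rewrite /cint (subr0_eq (esym G2)) (subr0_eq (esym G1)).
set d : C := 'D_1 (h : C^o -> C^o) (z : C^o).
have dhz : derivable (h : C^o -> C^o) (z : C^o) 1.
  by rewrite -[X in derivable _ X _]addr0; apply: dh; rewrite cmod0 ltW.
suff le_e (e : R) : 0 < e ->
    cmod (cint (fun y => (h (z + circ r y) - h z) / circ r y) - (2 * pi)%:C%C * d) <=
    2 * e * (2 * pi).
  apply/eqP; rewrite -subr_eq0 -cmod_eq0 eq_le cmod_ge0 andbT.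
  apply/ler_addgt0Pl => e e0; rewrite addr0.
  have p4 : 0 < 4 * pi :> R by rewrite mulr_gt0// pi_gt0.
  (* The value 4 pi undoes the factors 2 and 2 pi of [cint_approx]. *)
  apply: le_trans (le_e (e / (4 * pi)) (divr_gt0 e0 p4)) _.
  have E (p : R) : p != 0 -> 2 * (e / (4 * p)) * (2 * p) = e by move=> p0; field.
  by rewrite E// lt0r_neq0// pi_gt0.
move=> e0; have [t t0 tP] := (is_derive_linear_approx z h d).1 (derivableP dhz) e e0.
(* The circle of radius exp s then lies inside the given one and within distance t of the centre,
   where the linear approximation of [h] applies. *)
pose s := Num.min (ln r) (ln (t / 2)).
have sr : s <= ln r by rewrite ge_min lexx.
rewrite (const s sr); apply: cint_approx; first exact: cK.
move=> y _; have mdc : cmod (cexp (s +i* y)%C) < t.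
  rewrite cmod_cexp/=; apply: (@le_lt_trans _ _ (t / 2)); last first.
    by rewrite ltr_pdivrMr// ltr_pMr// ltr1n.
  have t2 : 0 < t / 2 by rewrite divr_gt0.
  by apply: le_trans (_ : expR (ln (t / 2)) <= _);
    [rewrite ler_expR ge_min lexx orbT|rewrite lnK].
have ne := cexp_neq0 (s +i* y)%C.
rewrite -(ler_pM2r (x := cmod (cexp (s +i* y)%C))) ?cmod_gt0// -cmodM.
by rewrite mulrBl /K divfK//; exact: tP.
Qed.

End CircleIntegral.

(** * The derivative of a holomorphic function is holomorphic *)

Section Regularity.
Variable R : realType.
Local Notation C := R[i].
Implicit Types (h : C -> C) (z w u v : C).

Let two_pi_gt0 : 0 < 2 * pi :> R. Proof. by rewrite mulr_gt0// pi_gt0. Qed.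

Let cmod_two_pi z (M : R) : cmod ((2 * pi)%:C%C * z) <= M * (2 * pi) -> cmod z <= M.
Proof. by rewrite cmodM cmodR gtr0_norm// [leLHS]mulrC ler_pM2r. Qed.

(* The formula of [circle_difference_quotient] holds with one radius [r] at every
   centre near [w]. It bounds [h'], hence makes [h] and then [h'] Lipschitz, so
   [h] has a first-order expansion with a uniform quadratic remainder, and the
   formula carries this expansion over to [h']. *)
Lemma derivable_derive h w (rho : R) : 0 < rho ->
  (forall u, cmod u < rho -> derivable (h : C^o -> C^o) (w + u : C^o) 1) ->
  derivable (fun z : C^o => 'D_1 (h : C^o -> C^o) z : C^o) (w : C^o) 1.
Proof.
move=> rho0 dh.
(* Going through an existential keeps h' opaque. *)
have [h' h'E] : exists h' : C -> C, h' = fun z => 'D_1 (h : C^o -> C^o) (z : C^o).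
  by exists (fun z => 'D_1 (h : C^o -> C^o) (z : C^o)).
rewrite -[X in derivable X _ _]h'E.
have is_d z : derivable (h : C^o -> C^o) (z : C^o) 1 ->
    is_derive (z : C^o) 1 (h : C^o -> C^o) (h' z) by rewrite h'E => /derivableP.
have [|t t0 tP] := @derivable_cmod_continuous R h w _ 1 ltr01.
  by rewrite -[X in derivable _ X _]addr0; apply: dh; rewrite cmod0.
(* Every passage from [h] to h' costs one radius: [h] is controlled for |u| < 4 r, h' is bounded for
   3 r, Lipschitz for 2 r, and the expansion has base points p with |p| <= r. *)
have [r r0 [r4rho r4t]] : exists2 r : R, 0 < r & 4 * r <= rho /\ 4 * r <= t.
  exists (Num.min rho t / 4); first by rewrite divr_gt0// lt_min rho0.
  by rewrite mulrC divfK// !ge_min !lexx orbT.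
have {}dh u : cmod u < 4 * r -> derivable (h : C^o -> C^o) (w + u : C^o) 1.
  by move=> ur; apply: dh; exact: lt_le_trans r4rho.
have {tP}h1 u : cmod u < 4 * r -> cmod (h (w + u) - h w) <= 1.
  by move=> ur; apply/ltW/tP; exact: lt_le_trans r4t.
have cq u : cmod u < 3 * r -> forall v, cmod v <= r ->
    derivable (h : C^o -> C^o) (w + u + v : C^o) 1.
  move=> ur v vr; rewrite -addrA; apply: dh.
  by apply: le_lt_trans (cmodD _ _) _; lra.
pose q z y := (h (z + circ r y) - h z) / circ r y.
have qP u : cmod u < 3 * r -> ccont (q (w + u)) /\
    cint (q (w + u)) = (2 * pi)%:C%C * h' (w + u).
  by move=> ur; rewrite h'E; exact: circle_difference_quotient r0 (cq u ur).
have cmod_div z y (M : R) : cmod z <= M -> cmod (z / circ r y) <= M / r.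
  by move=> zM; rewrite cmodM cmodV cmod_circ// ler_pM2r ?invr_gt0.
have h'_bound u : cmod u < 3 * r -> cmod (h' (w + u)) <= 4 / r.
  move=> ur; have [c E] := qP u ur; apply: cmod_two_pi; rewrite -E.
  have -> : 4 / r = 2 * (2 / r) by ring.
  apply: (cint_bound c) => y _; apply: cmod_div.
  rewrite -addrA (_ : _ - _ = (h (w + (u + circ r y)) - h w) - (h (w + u) - h w));
    last by ring.
  apply: le_trans (cmodD _ _) _; rewrite cmodN -[2]/(1 + 1); apply: lerD; apply: h1.
    by apply: le_lt_trans (cmodD _ _) _; rewrite cmod_circ//; lra.
  lra.
(* Discs are convex, so the mean value bound may be used between any two of their points. *)
have seg u v (k : R) (s : R) : cmod u < k -> cmod (u + v) < k -> 0 <= s <= 1 ->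
    cmod (u + s%:C%C * v) < k.
  move=> uk vk /andP[s0 s1].
  have -> : u + s%:C%C * v = (1 - s)%:C%C * u + s%:C%C * (u + v).
    by rewrite rmorphB/= rmorph1; ring.
  apply: le_lt_trans (cmodD _ _) _; rewrite !cmodM !cmodR !ger0_norm ?subr_ge0//.
  apply: (@le_lt_trans _ _ (Num.max (cmod u) (cmod (u + v)))); last by rewrite gt_max uk.
  have um : cmod u <= Num.max (cmod u) (cmod (u + v)) by rewrite le_max lexx.
  have vm : cmod (u + v) <= Num.max (cmod u) (cmod (u + v)) by rewrite le_max lexx orbT.
  have s1' : 0 <= 1 - s by lra.
  have := lerD (ler_wpM2l s1' um) (ler_wpM2l s0 vm).
  by rewrite -mulrDl subrK mul1r.
have h_lip u v : cmod u < 3 * r -> cmod (u + v) < 3 * r ->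
    cmod (h (w + (u + v)) - h (w + u)) <= 8 / r * cmod v.
  move=> ur vr; have -> : 8 / r = 2 * (4 / r) by ring.
  rewrite addrA; apply: mean_value_bound => s sI; rewrite -addrA.
  have usv := seg u v _ s ur vr sI.
  have usv' : cmod (u + s%:C%C * v) < 4 * r by lra.
  by have := h'_bound _ usv; rewrite h'E; split => //; exact: dh.
(* The difference of two quotients contains two increments of [h], each at most 8 / r |v|; dividing
   by r and the factor 2 of [cint_bound] give 32 / r^2. *)
have h'_lip u v : cmod u < 2 * r -> cmod (u + v) < 2 * r ->
    cmod (h' (w + (u + v)) - h' (w + u)) <= 32 / r ^+ 2 * cmod v.
  move=> ur vr; have u3 : cmod u < 3 * r by lra.
  have v3 : cmod (u + v) < 3 * r by lra.
  have [c1 E1] := qP u u3; have [c2 E2] := qP (u + v) v3.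
  apply: cmod_two_pi; rewrite mulrBr -E1 -E2 -(cintB c2 c1).
  have -> : 32 / r ^+ 2 * cmod v = 2 * (16 / r * cmod v / r) by field; exact: lt0r_neq0.
  apply: cint_bound; first exact: (ccontB c2 c1).
  move=> y _; rewrite -mulrBl; apply: cmod_div.
  have -> : 16 / r * cmod v = 8 / r * cmod v + 8 / r * cmod v by field; exact: lt0r_neq0.
  have yu : cmod (u + circ r y) < 3 * r.
    by apply: le_lt_trans (cmodD _ _) _; rewrite cmod_circ//; lra.
  have yv : cmod (u + circ r y + v) < 3 * r.
    rewrite addrAC; apply: le_lt_trans (cmodD _ _) _; rewrite cmod_circ//; lra.
  have := lerD (h_lip _ _ yu yv) (h_lip _ _ u3 v3); apply: le_trans.
  rewrite -[X in _ <= _ + X]cmodN; apply: le_trans (cmodD _ _).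
  rewrite [u + circ r y + v]addrAC !addrA.
  by rewrite le_eqVlt; apply/orP; left; apply/eqP; congr cmod; ring.
pose D := 32 / r ^+ 2.
have D0 : 0 <= D by rewrite divr_ge0// exprn_ge0// ltW.
(* The mean value bound for h(z) - h'(w + p) z, whose derivative is at most D |u| along the segment
   since h' is Lipschitz. *)
have taylor p u : cmod p <= r -> cmod u < r ->
    cmod (h (w + (p + u)) - h (w + p) - h' (w + p) * u) <= 2 * D * cmod u ^+ 2.
  move=> pr ur; pose a := h' (w + p).
  have dg s : 0 <= s <= 1 -> is_derive (w + p + s%:C%C * u : C^o) 1
      ((fun z => h z - a * z) : C^o -> C^o) (h' (w + p + s%:C%C * u) - a).
    move=> sI; have sr := seg p u (2 * r) s.
    have d1 : is_derive (w + p + s%:C%C * u : C^o) 1 (h : C^o -> C^o)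
        (h' (w + p + s%:C%C * u)).
      apply: is_d; rewrite -addrA; apply: dh.
      apply: lt_trans (_ : 2 * r < _); last by lra.
      by apply: sr => //; last apply: le_lt_trans (cmodD _ _) _; lra.
    apply: is_deriveB d1 _.
    have := @is_deriveZ C C^o C^o id a (w + p + s%:C%C * u) 1 1 (is_derive_id _ _).
    by rewrite -[a *: 1]/(a * 1) mulr1.
  have := @mean_value_bound R (fun z => h z - a * z) (w + p) u (D * cmod u).
  have -> : h (w + p + u) - a * (w + p + u) - (h (w + p) - a * (w + p)) =
    h (w + (p + u)) - h (w + p) - a * u by rewrite -[w + p + u]addrA; ring.
  have -> : 2 * (D * cmod u) * cmod u = 2 * D * cmod u ^+ 2 by ring.
  apply=> s sI; have [df ->] := dg s sI; split=> //.
  have p2 : cmod p < 2 * r by lra.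
  have pu2 : cmod (p + u) < 2 * r by apply: le_lt_trans (cmodD _ _) _; lra.
  have sr := seg p u (2 * r) s p2 pu2 sI.
  have := h'_lip p (s%:C%C * u) p2 sr; rewrite addrA => /le_trans; apply.
  rewrite ler_wpM2l// cmodM cmodR -[leRHS]mul1r ler_wpM2r ?cmod_ge0//.
  by have /andP[s0 s1] := sI; rewrite ger0_norm.
have c' : ccont (fun y => (h' (w + circ r y) - h' w) / circ r y).
  apply: ccontM; last exact: ccont_circV.
  apply: ccontB; last exact: ccont_cst.
  apply: ccont_cmod => y e e0; have D1 : 0 < D + 1 by lra.
  have m0 : 0 < Num.min r (e / (D + 1)) by rewrite lt_min r0 divr_gt0.
  have [s s0 sP] := circ_continuous r y m0.
  exists s => // y' ys; have := sP y' ys; rewrite lt_min => /andP[c1 c2].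
  have cr : cmod (circ r y) = r by exact: cmod_circ.
  have cr' : cmod (circ r y') = r by exact: cmod_circ.
  have := h'_lip (circ r y) (circ r y' - circ r y); rewrite subrKC cr cr' => /(_ _ _)/le_lt_trans.
  apply; [lra|lra|]; apply: le_lt_trans (_ : (D + 1) * cmod (circ r y' - circ r y) < _).
    by rewrite ler_wpM2r ?cmod_ge0// lerDl.
  by rewrite mulrC -ltr_pdivlMr.
(* The candidate for h''(w) is what the circle formula would give for h' in place of [h]; the
   formula itself cannot be used yet, only continuity of the integrand. *)
pose d := cint (fun y => (h' (w + circ r y) - h' w) / circ r y) / (2 * pi)%:C%C.
have dE : (2 * pi)%:C%C * d = cint (fun y => (h' (w + circ r y) - h' w) / circ r y).
  by rewrite mulrC divfK// eq_complex/= eqxx andbT lt0r_neq0.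
suff : is_derive (w : C^o) 1 (h' : C^o -> C^o) d by case.
apply/is_derive_linear_approx => e e0.
(* The integrand of the remainder is a difference of two expansions, at p = [circ r y] and p = 0,
   each off by at most 2 D |u|^2; dividing by r and doubling gives E. *)
pose E := 8 * D / r.
have E1 : 0 < E + 1.
  by rewrite ltr_wpDl// divr_ge0 ?(ltW r0)// mulr_ge0.
exists (Num.min r (e / (E + 1))); first by rewrite lt_min r0 divr_gt0.
move=> u; rewrite lt_min ltr_pdivlMr// => /andP[ur ue].
have u3 : cmod u < 3 * r by lra.
have z3 : cmod 0 < 3 * r by rewrite cmod0; lra.
have [c1 E1'] := qP u u3; have [c2 E2'] := qP 0 z3; rewrite addr0 in c2 E2'.
apply: le_trans (_ : E * cmod u * cmod u <= _); last first.
  by rewrite ler_wpM2r ?cmod_ge0//; have := cmod_ge0 u; lra.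
apply: cmod_two_pi; rewrite !mulrBr [_ * (d * u)]mulrA dE -E1' -E2'.
rewrite -(cintB c1 c2) [cint _ * u]mulrC -(cintZ u c').
have c3 : ccont (fun y => u * ((h' (w + circ r y) - h' w) / circ r y)).
  by apply: ccontM => //; exact: ccont_cst.
rewrite -(cintB (ccontB c1 c2) c3).
have -> : E * cmod u * cmod u = 2 * (4 * D * cmod u ^+ 2 / r) by rewrite /E; ring.
apply: cint_bound; first exact: (ccontB (ccontB c1 c2) c3).
move=> y _; rewrite mulrA -!mulrBl; apply: cmod_div.
have crr : cmod (circ r y) <= r by rewrite cmod_circ.
have z0 : cmod 0 <= r by rewrite cmod0 ltW.
have := lerD (taylor _ _ crr ur) (taylor _ _ z0 ur).
have -> : 2 * D * cmod u ^+ 2 + 2 * D * cmod u ^+ 2 = 4 * D * cmod u ^+ 2 by ring.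
apply: le_trans; rewrite -[X in _ <= _ + X]cmodN; apply: le_trans (cmodD _ _).
rewrite add0r addr0 [circ r y + u]addrC addrA.
by rewrite le_eqVlt; apply/orP; left; apply/eqP; congr cmod; ring.
Qed.

End Regularity.

(** * Orthonormal bases *)

Section InnerProduct.
Variables (R : realType) (H : hilbertType R).
Local Notation C := R[i].
Implicit Types (x y z : H) (e f : nat -> H) (a : C).

Definition nsq x : R := complex.Re (inner x x).

Lemma innerDl x y z : inner (x + y) z = inner x z + inner y z.
Proof. by rewrite linearDl. Qed.
Lemma innerBl x y z : inner (x - y) z = inner x z - inner y z.
Proof. by rewrite linearBl. Qed.
Lemma innerZl a x y : inner (a *: x) y = a * inner x y.
Proof. by rewrite linearZl_LR. Qed.
Lemma innerC x y : inner x y = (inner y x)^*.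
Proof. by rewrite hermC/= expr0 mul1r. Qed.
Lemma innerDr x y z : inner x (y + z) = inner x y + inner x z.
Proof. by rewrite linearDr. Qed.
Lemma innerBr x y z : inner x (y - z) = inner x y - inner x z.
Proof. by rewrite linearBr. Qed.
Lemma innerZr a x y : inner x (a *: y) = a^* * inner x y.
Proof. by rewrite linearZr_LR. Qed.
Lemma inner0l y : inner 0 y = 0. Proof. by rewrite linear0l. Qed.
Lemma inner0r x : inner x 0 = 0. Proof. by rewrite linear0r. Qed.
Lemma inner_suml I (r : seq I) (P : pred I) (E : I -> H) y :
  inner (\sum_(i <- r | P i) E i) y = \sum_(i <- r | P i) inner (E i) y.
Proof.
elim/big_rec2: _ => [|i z s _ <-]; first exact: inner0l.
by rewrite innerDl.
Qed.
Lemma inner_sumr I (r : seq I) (P : pred I) (E : I -> H) x :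
  inner x (\sum_(i <- r | P i) E i) = \sum_(i <- r | P i) inner x (E i).
Proof.
elim/big_rec2: _ => [|i z s _ <-]; first exact: inner0r.
by rewrite innerDr.
Qed.

Lemma nsqE x : inner x x = (nsq x)%:C%C.
Proof.
have := dnorm_ge0 (@inner R H) x; rewrite /nsq.
by case: (inner x x) => a b; rewrite lecE/= => /andP[/eqP -> _].
Qed.

Lemma nsq_ge0 x : 0 <= nsq x.
Proof. by rewrite -lecR -nsqE dnorm_ge0. Qed.

Lemma nsq_eq0 x : (nsq x == 0) = (x == 0).
Proof.
rewrite -(dnorm_eq0 (@inner R H)) nsqE.
by apply/eqP/eqP => [->//|/complexI].
Qed.

Lemma norm_nsq x : `|x| ^+ 2 = (nsq x)%:C%C.
Proof. by rewrite norm_innerE nsqE. Qed.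

Lemma nsqD_orth x y : inner x y = 0 -> nsq (x + y) = nsq x + nsq y.
Proof.
by move=> xy; apply: complexI; rewrite rmorphD/= -!nsqE hnormDd.
Qed.

Lemma nsqZ a x : nsq (a *: x) = sqmod a * nsq x.
Proof.
by apply: complexI; rewrite rmorphM/= -!nsqE sqmodC dnormZ.
Qed.

Lemma cauchy_schwarz x y : `|inner x y| <= `|x| * `|y|.
Proof.
rewrite -ler_sqr ?nnegrE ?mulr_ge0// exprMn !norm_innerE; exact: dot_CS.
Qed.

Lemma inner_separates x y : (forall z, inner x z = inner y z) -> x = y.
Proof.
move=> xy; apply/eqP; rewrite -subr_eq0 -(dnorm_eq0 (@inner R H)).
by rewrite innerBl xy subrr.
Qed.

Lemma lt_norm_nsq x (r : R) : 0 < r -> `|x| < r%:C%C -> nsq x < r ^+ 2.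
Proof.
move=> r0 xr; rewrite -ltcR -norm_nsq rmorphXn/= ltr_pXn2r// nnegrE//.
by rewrite lecR ltW.
Qed.

Definition orthonormal_seq e := forall m n, inner (e m) (e n) = (m == n)%:R.

Section Parseval.
Variable e : nat -> H.
Hypothesis e_on : orthonormal_seq e.

Lemma inner_lincomb (c : nat -> C) N j :
  inner (\sum_(0 <= k < N) c k *: e k) (e j) = if (j < N)%N then c j else 0.
Proof.
rewrite inner_suml; under eq_bigr do rewrite innerZl e_on.
case: ifP => [jN|Nj].
  rewrite (bigD1_seq j) ?mem_index_iota ?iota_uniq//= eqxx mulr1 big1 ?addr0// => i /negPf ->.
  by rewrite mulr0.
rewrite big_nat_cond big1// => i /andP[/andP[_ iN] _].
by have [ij|] := eqVneq i j; [rewrite -ij iN in Nj|rewrite mulr0].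
Qed.

Lemma nsq_lincomb (c : nat -> C) M N :
  nsq (\sum_(M <= k < N) c k *: e k) = \sum_(M <= k < N) sqmod (c k).
Proof.
have [MN|NM] := leqP M N; last first.
  by rewrite !big_geq ?(ltnW NM)// /nsq inner0l.
elim: N MN => [|N IH]; first by rewrite leqn0 => /eqP ->; rewrite !big_geq// /nsq inner0l.
rewrite leq_eqVlt => /predU1P[->|]; first by rewrite !big_geq// /nsq inner0l.
rewrite ltnS => MN; rewrite !big_nat_recr//= nsqD_orth ?IH// ?nsqZ.
  by rewrite /nsq e_on eqxx mulr1.
rewrite inner_suml big_nat_cond big1// => i /andP[/andP[_ iN] _].
by rewrite innerZl innerZr e_on ltn_eqF// mulr0 mulr0.
Qed.

Definition fourier_sum x N := \sum_(0 <= k < N) inner x (e k) *: e k.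

Lemma fourier_sum_orth x N j : (j < N)%N -> inner (x - fourier_sum x N) (e j) = 0.
Proof. by move=> jN; rewrite innerBl inner_lincomb jN subrr. Qed.

Lemma nsq_fourier x N :
  nsq x = nsq (x - fourier_sum x N) + \sum_(0 <= k < N) sqmod (inner x (e k)).
Proof.
rewrite -nsq_lincomb -nsqD_orth ?subrK// inner_sumr big_nat_cond big1//.
by move=> i /andP[/andP[_ iN] _]; rewrite innerZr fourier_sum_orth// mulr0.
Qed.

Lemma bessel x N : \sum_(0 <= k < N) sqmod (inner x (e k)) <= nsq x.
Proof. by rewrite (nsq_fourier x N) lerDr nsq_ge0. Qed.

(** The Fourier sum is the best approximation: once N passes every index used by a nearby y in the
    span, x minus the sum is orthogonal to the sum minus y, so it is no longer than x - y. *)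
Lemma parseval x : closure (linear_span (range e)) = setT ->
  series (fun n => sqmod (inner x (e n))) @ \oo --> nsq x.
Proof.
move=> dense; apply/cvgrPdist_lt => d d0.
(* Then r^2 <= r <= d, as the estimate concerns squared norms. *)
pose r := Num.min d 1; have r0 : 0 < r by rewrite lt_min d0 ltr01.
have : closure (linear_span (range e)) x by rewrite dense.
have rC : 0 < r%:C%C by rewrite ltcR.
move=> /(_ (ball x r%:C%C) (nbhsx_ballx _ _ rC))[y [[n [c [v [ev yE]]]]]].
rewrite -ball_normE /= => xy.
have /choice[m mE] i : exists k, e k = v i by have [k _] := ev i; exists k.
exists (\max_(i < n) (m i).+1)%N => // N /= mN.
have nsqxy := lt_norm_nsq r0 xy.
have yN : inner (x - fourier_sum x N) (fourier_sum x N - y) = 0.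
  rewrite innerBr inner_sumr big_nat_cond big1 ?sub0r.
    apply/eqP; rewrite oppr_eq0 yE inner_sumr big1// => i _.
    rewrite innerZr -(mE i) fourier_sum_orth ?mulr0//.
    by apply: leq_trans mN; exact: (leq_bigmax_cond (F := fun i => (m i).+1)).
  by move=> i /andP[/andP[_ iN] _]; rewrite innerZr fourier_sum_orth// mulr0.
rewrite [X in X - _](nsq_fourier x N) addrK ger0_norm ?nsq_ge0//.
apply: le_lt_trans (_ : nsq (x - y) < _).
  by rewrite -[x - y](subrKA (fourier_sum x N)) [leRHS]nsqD_orth// lerDl nsq_ge0.
apply: lt_le_trans nsqxy _; apply: le_trans (_ : r <= _); last by rewrite ge_min lexx.
by rewrite expr2 ler_piMr ?(ltW r0)// ge_min lexx orbT.
Qed.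

Lemma riesz_fischer (l : nat -> C) : cvgn (series (fun n => sqmod (l n))) ->
  exists x, forall n, inner x (e n) = l n.
Proof.
move=> /cauchy_cvgP/cauchy_seriesP cl.
have cv : cvgn (series (fun n => l n *: e n)).
  apply: cauchy_cvg; apply/cauchy_seriesP => _ /ltc_real[d d0 ->].
  have d20 : 0 < d ^+ 2 by rewrite exprn_gt0.
  apply: filterS (cl _ d20) => -[m n] /=.
  rewrite ger0_norm ?sumr_ge0//; last by move=> i _; exact: sqmod_ge0.
  rewrite -nsq_lincomb -ltcR -norm_nsq rmorphXn/= ltr_pXn2r ?nnegrE//.
  by rewrite lecR ltW.
exists (limn (series (fun n => l n *: e n))) => n.
set x := limn _; apply/eqP; rewrite -subr_eq0 -normr_le0.
apply/ler_addgt0Pl => d d0; rewrite addr0.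
have : series (fun n => l n *: e n) @ \oo --> x by exact: cv.
move=> /cvgrPdist_lt /(_ d d0)[N _ NP].
have := NP (maxn N n.+1) (leq_maxl _ _); set s := series _ _ => /ltW.
have sn : inner s (e n) = l n.
  by rewrite /s /series/= inner_lincomb leq_maxr.
move=> xs; rewrite -sn -innerBl; apply: le_trans (cauchy_schwarz _ _) _.
have -> : `|e n| = 1; last by rewrite mulr1.
apply/eqP; rewrite -(eqrXn2 (n := 2))// norm_innerE e_on eqxx expr1n//.
Qed.

End Parseval.

End InnerProduct.

Section Isometry.
Variables (R : realType) (H K : hilbertType R).

(** Polarization: x + y yields the real part, and replacing y by iy the imaginary part. *)
Lemma isometry_inner (W : {linear H -> K}) :
  (forall x, inner (W x) (W x) = inner x x) ->
  forall x y, inner (W x) (W y) = inner x y.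
Proof.
move=> isoW.
have ReW x y : complex.Re (inner (W x) (W y)) = complex.Re (inner x y).
  have := isoW (x + y); rewrite linearD !innerDl !innerDr !isoW.
  rewrite [inner y x]innerC [inner (W y) (W x)]innerC => /(congr1 (@complex.Re R)).
  rewrite !cReD !cRe_conj; lra.
move=> x y; apply/eqP; rewrite eq_complex ReW eqxx/=.
have := ReW x ('i%C *: y); rewrite linearZ /= !innerZr.
have -> : ('i%C : R[i])^* = (0 -i* 1)%C by [].
by rewrite !cReM/= => h; apply/eqP; lra.
Qed.

End Isometry.

(** * Weighted shifts *)

Section SqMod.
Variable R : realType.
Implicit Types z w : R[i].

Lemma sqmod_cmod z : sqmod z = cmod z ^+ 2.
Proof. by rewrite sqmodE sqr_cmod. Qed.
Lemma sqmodM z w : sqmod (z * w) = sqmod z * sqmod w.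
Proof. by rewrite !sqmod_cmod cmodM exprMn. Qed.
Lemma sqmod_conj z : sqmod z^* = sqmod z.
Proof. by rewrite !sqmodE cRe_conj cIm_conj sqrrN. Qed.
Lemma sqmod1 : sqmod (1 : R[i]) = 1.
Proof. by rewrite sqmodE/= expr1n expr0n addr0. Qed.
Lemma sqmod_eq0 z : (sqmod z == 0) = (z == 0).
Proof. by rewrite sqmod_cmod expf_eq0/= cmod_eq0. Qed.
Lemma sqmod_gt0 z : (0 < sqmod z) = (z != 0).
Proof. by rewrite lt_def sqmod_eq0 sqmod_ge0 andbT. Qed.
Lemma sqmod_prod (I : Type) (r : seq I) (F : I -> R[i]) :
  sqmod (\prod_(i <- r) F i) = \prod_(i <- r) sqmod (F i).
Proof. by elim/big_rec2: _ => [|i x y _ <-]; rewrite ?sqmod1// sqmodM. Qed.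
Lemma conj_mul_sqmod1 z : sqmod z = 1 -> z^* * z = 1.
Proof. by move=> z1; rewrite mulrC -normCK -sqmodC z1. Qed.
End SqMod.

Section Unitary.
Variables (R : realType) (H : hilbertType R).
Local Notation C := R[i].

(** The coordinate map is isometric by Parseval and onto by Riesz-Fischer. *)
Lemma coordinate_unitary (f : nat -> H) : orthonormal_seq f ->
  (forall x, series (fun n => sqmod (inner x (f n))) @ \oo --> nsq x) ->
  exists W : {linear H -> l2 R},
    [/\ forall x y, inner (W x) (W y) = inner x y, range W = setT &
        forall x n, W x n = inner x (f n)].
Proof.
move=> f_on f_pars.
have sub x : (fun n => inner x (f n)) \in @square_summable R.
  by apply/square_summableP/cvg_ex; exists (nsq x); exact: f_pars.
pose W0 x : l2 R := L2 (sub x).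
have W0_lin : linear W0.
  move=> a x y; apply/val_inj/funext => n /=.
  by rewrite innerDl innerZl.
pose W : {linear H -> l2 R} := HB.pack W0 (GRing.isLinear.Build _ _ _ _ W0 W0_lin).
exists W; split => //.
  apply: isometry_inner => x; rewrite [RHS]nsqE.
  rewrite -[LHS]/(l2_inner (W x) (W x)) l2_innerxx; congr (_%:C%C).
  exact: cvg_lim (f_pars x).
rewrite -subTset => l _; have /square_summableP cl := l2_in l.
have [x xP] := riesz_fischer f_on cl.
by exists x => //; apply/val_inj/funext => n /=.
Qed.

End Unitary.

Section WeightedShift.
Variables (R : realType) (H : hilbertType R).
Local Notation C := R[i].
Variables (T Ts : H -> H) (e : nat -> H) (lambda : nat -> C).
Hypotheses (adj : is_adjoint T Ts) (e_basis : orthonormal_basis e).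
Hypothesis TsE : forall n, Ts (e n) = lambda n *: e n.+1.

Let e_on : orthonormal_seq e. Proof. by case: e_basis. Qed.

Let e_pars x : series (fun n => sqmod (inner x (e n))) @ \oo --> nsq x.
Proof. by apply: parseval => //; case: e_basis. Qed.

Lemma basis_total x : (forall n, inner x (e n) = 0) -> x = 0.
Proof.
move=> x0; apply/eqP; rewrite -nsq_eq0; apply/eqP.
rewrite -(cvg_lim _ (@e_pars x))//.
rewrite [X in limn X](_ : _ = fun=> 0) ?lim_cst//.
by apply/funext => n; rewrite /series/= big1// => i _; rewrite x0 sqmodE/= expr0n addr0.
Qed.

Lemma shift_coord x n : inner (T x) (e n) = (lambda n)^* * inner x (e n.+1).
Proof. by rewrite adj TsE innerZr. Qed.

Lemma shift_basis0 : T (e 0%N) = 0.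
Proof. by apply: basis_total => n; rewrite shift_coord e_on mulr0. Qed.

(** A vanishing weight would put [e n.+1] into the kernel beside [e 0]: two orthonormal vectors on
    one line. *)
Lemma shift_weight_neq0 n : one_dimensional (eigen_kernel T 0) -> lambda n != 0.
Proof.
move=> [v v0 kerE]; apply/eqP => ln0.
have in_ker x : T x = 0 -> exists c, x = c *: v.
  move=> Tx; have : eigen_kernel T 0 x by rewrite /eigen_kernel/= Tx scale0r subrr.
  by rewrite kerE => -[c _ <-]; exists c.
have [|c cE] := in_ker (e n.+1).
  apply: basis_total => m; rewrite shift_coord e_on eqSS eq_sym.
  by case: eqP => [->|]; rewrite ?ln0 ?rmorph0 ?mul0r ?mulr0.
have [d dE] := in_ker _ shift_basis0.
have := e_on 0%N n.+1; rewrite cE dE innerZl innerZr /= => /eqP.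
rewrite !mulf_eq0 conjC_eq0 dnorm_eq0 (negPf v0) orbF => /orP[] /eqP z0.
  have := e_on 0%N 0%N; rewrite dE z0 scale0r inner0l => /esym/eqP.
  by rewrite oner_eq0.
have := e_on n.+1 n.+1; rewrite cE z0 scale0r inner0l eqxx => /esym/eqP.
by rewrite oner_eq0.
Qed.

Let norm_e n : `|e n| = 1.
Proof. by apply/eqP; rewrite -(eqrXn2 (n := 2))// norm_innerE e_on eqxx expr1n. Qed.

Lemma shift_weight_le1 n : contractive T -> sqmod (lambda n) <= 1.
Proof.
move=> cT; rewrite -sqmod_conj; have := shift_coord (e n.+1) n.
rewrite e_on eqxx mulr1 => <-.
rewrite -lecR sqmodC rmorph1 expr_le1//.
apply: le_trans (cauchy_schwarz _ _) _; rewrite norm_e mulr1.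
by apply: le_trans (cT _) _; rewrite norm_e.
Qed.

(** At [e n.+1] cohyponormality says that T is no longer than its adjoint, and these lengths are
    |lambda n| and |lambda n.+1|. *)
Lemma shift_weight_nondecreasing n : cohyponormal T ->
  sqmod (lambda n) <= sqmod (lambda n.+1).
Proof.
move=> [Ts' [adj' [Tss [adjs pos]]]].
(* The adjoints hidden in [cohyponormal] are only given by a relation; uniqueness identifies them
   with [Ts] and [T]. *)
have TsTs' x : Ts' x = Ts x.
  by apply: inner_separates => z; rewrite innerC -adj' adj -innerC.
have TssT x : Tss x = T x.
  by apply: inner_separates => z; rewrite innerC -adjs TsTs' innerC conjCK -adj.
have := pos (e n.+1); rewrite innerBl !TssT !TsTs' adj TsE innerZl innerZr e_on.
rewrite eqxx mulr1 -normCK -sqmodC innerC -adj nsqE subr_ge0.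
have -> : ((nsq (T (e n.+1)))%:C%C : C)^* = (nsq (T (e n.+1)))%:C%C.
  by apply/eqP; rewrite eq_complex cRe_conj cIm_conj /= oppr0 !eqxx.
rewrite lecR; apply: le_trans; apply: le_trans (bessel e_on (T (e n.+1)) n.+1).
rewrite big_nat_recr//= shift_coord e_on eqxx mulr1 sqmod_conj lerDr.
by apply: sumr_ge0 => i _; exact: sqmod_ge0.
Qed.

(** Comparing coordinates in T x = z x gives a recursion that determines all of them from the one at
    [e 0]. *)
Lemma shift_eigenvector x z n : (forall m, lambda m != 0) -> T x = z *: x ->
  sqmod (inner x (e n)) =
  sqmod (inner x (e 0%N)) * (\prod_(0 <= k < n) (sqmod (lambda k))^-1 * sqmod z ^+ n).
Proof.
move=> l0 Tx; elim: n => [|n IH]; first by rewrite big_geq// expr0 !mulr1.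
have := shift_coord x n; rewrite Tx innerZl => /(congr1 (@sqmod R)).
rewrite !sqmodM sqmod_conj IH big_nat_recr//= exprS => E.
apply: (mulfI (x := sqmod (lambda n))); first by rewrite sqmod_eq0.
rewrite -E; field; by rewrite sqmod_eq0.
Qed.

(** The unimodular factors [p n] absorb the phases of the weights: T sends p_(n+1) e_(n+1) to p_n
    e_n. *)
Lemma shift_unitary : (forall n, sqmod (lambda n) = 1) ->
  unitarily_equivalent T (@backward_shift R).
Proof.
move=> l1; pose p n : C := \prod_(0 <= k < n) lambda k.
have p1 n : sqmod (p n) = 1 by rewrite sqmod_prod big1.
have [||W [W1 W2 W3]] := @coordinate_unitary R H (fun n => p n *: e n).
- move=> m n; rewrite innerZl innerZr e_on.
  case: eqP => [->|]; last by rewrite !mulr0.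
  by rewrite mulr1 mulrC conj_mul_sqmod1.
- move=> x; rewrite [X in series X](_ : _ = fun n => sqmod (inner x (e n))) //.
  by apply/funext => n; rewrite innerZr sqmodM sqmod_conj p1 mul1r.
exists W; split=> // x; apply/val_inj/funext => n /=.
rewrite !W3 !innerZr shift_coord /p big_nat_recr//= rmorphM/=.
by rewrite mulrA.
Qed.

End WeightedShift.

(** * Power series with nonnegative coefficients *)

Section PowerSeries.
Variable R : realType.
Implicit Types (a c : R^nat) (r x K t : R).

(** Each of the n + 1 terms of the geometric sum up to x^n is at least x^n. This absorbs the factor
    n + 1 produced by differentiation. *)
Lemma geometric_mul_bound x n : 0 <= x < 1 -> n.+1%:R * x ^+ n <= (1 - x)^-1.
Proof.
move=> /andP[x0 x1]; have x1' : 0 < 1 - x by rewrite subr_gt0.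
rewrite -[leRHS]mul1r ler_pdivlMr//.
apply: le_trans (_ : (\sum_(i < n.+1) x ^+ i) * (1 - x) <= _).
  rewrite ler_pM2r// -[n.+1 in leLHS]card_ord -sumr_const mulr_suml ler_sum// => i _.
  by rewrite mul1r ler_wiXn2l// ?(ltW x1)// leq_ord.
by rewrite mulrC -opprB mulNr -subrX1 opprB lerBlDr lerDl exprn_ge0.
Qed.

Lemma is_cvg_pseries_diffs c K x : cvgn (pseries c K) -> `|x| < `|K| ->
  cvgn (pseries (pseries_diffs c) x).
Proof.
(* The gap between |x| and y supplies a geometric factor q^n, q = |x| / y, to pay for n + 1. *)
move=> cK xK; pose y := (`|x| + `|K|) / 2.
have [xy yK] : `|x| < y /\ y < `|K| by rewrite /y; lra.
have y0 : 0 < y by apply: le_lt_trans xy.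
have yK' : `|y| < `|K| by rewrite gtr0_norm.
have := is_cvg_pseries_inside_norm cK yK'.
pose q := `|x| / y.
have qI : 0 <= q < 1 by rewrite divr_ge0//= ?(ltW y0)// ltr_pdivrMr// mul1r.
move=> cy; apply: normed_cvg.
have cy' : cvgn (series (fun n => `|c n.+1| * y ^+ n.+1)).
  rewrite [X in cvgn X](_ : _ = (fun n => pseries (fun i => `|c i|) y n.+1 - `|c 0%N|)).
    apply: is_cvgB; last exact: is_cvg_cst.
    by apply/cvg_ex; case/cvg_ex: cy => l yl; exists l;
      rewrite (cvg_shiftS (pseries (fun i => `|c i|) y)).
  apply/funext => n; rewrite /pseries /series/= big_nat_recl//= expr0 mulr1.
  by rewrite addrC addKr.
have := @is_cvg_seriesZ _ _ ((1 - q)^-1 / y) cy'.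
apply: series_le_cvg => n //=.
  by rewrite mulr_ge0 ?mulr_ge0 ?invr_ge0 ?exprn_ge0 ?(ltW y0)// subr_ge0 ltW//; case/andP: qI.
have xE : `|x| = q * y by rewrite /q divfK// gt_eqF.
rewrite /pseries_diffs !normrM normrX xE normr_nat exprMn.
rewrite [leLHS](_ : _ = (n.+1%:R * q ^+ n) * (`|c n.+1| * y ^+ n)); last by ring.
rewrite [leRHS](_ : _ = (1 - q)^-1 * (`|c n.+1| * y ^+ n)).
  rewrite ler_wpM2r ?mulr_ge0 ?exprn_ge0 ?(ltW y0)//.
  exact: geometric_mul_bound.
rewrite -[LHS]/((1 - q)^-1 / y * (`|c n.+1| * y ^+ n.+1)) exprS; field.
by rewrite !gt_eqF// subr_gt0; case/andP: qI.
Qed.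

Definition increments a n := if n is m.+1 then a m.+1 - a m else a 0%N.

Lemma increments_ge0 a n : 0 <= a 0%N -> (forall n, a n <= a n.+1) ->
  0 <= increments a n.
Proof. by move=> a0 aS; case: n => //= n; rewrite subr_ge0. Qed.

Lemma cvg_pseries_increments a r : cvgn (pseries a r) ->
  pseries (increments a) r @ \oo --> (1 - r) * limn (pseries a r).
Proof.
move=> ca; have E n : pseries (increments a) r n.+1 =
    pseries a r n.+1 - r * pseries a r n.
  rewrite /pseries /series/=; elim: n => [|n IH].
    by rewrite !big_nat1 big_geq// mulr0 subr0.
  rewrite big_nat_recr//= IH [in RHS]big_nat_recr//=.
  by rewrite ![\sum_(0 <= _ < n.+1) _]big_nat_recr//= exprS; ring.
rewrite -(cvg_shiftS (pseries (increments a) r)); under eq_fun do rewrite E.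
rewrite mulrBl mul1r; apply: cvgB; first by rewrite (cvg_shiftS (pseries a r)).
by apply: cvgM => //; exact: cvg_cst.
Qed.

Variable c : R^nat.
Hypothesis c0 : c 0%N = 1.
Hypothesis c_ge0 : forall n, 0 <= c n.
Hypothesis c_cvg : forall r, 0 <= r < 1 -> cvgn (pseries c r).

Definition psum c r : R := limn (pseries c r).

Let between r : `|r| < 1 -> exists2 K, 0 <= K < 1 & `|r| < `|K|.
Proof.
move=> r1; exists ((`|r| + 1) / 2).
  by have := normr_ge0 r; move=> ?; apply/andP; split; lra.
by rewrite [ltRHS]ger0_norm; have := normr_ge0 r; lra.
Qed.

Lemma c_cvg_in r : `|r| < 1 -> cvgn (pseries c r).
Proof.
by move=> /between[K /c_cvg cK rK]; exact: is_cvg_pseries_inside cK rK.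
Qed.

Lemma c1_cvg_in r : `|r| < 1 -> cvgn (pseries (pseries_diffs c) r).
Proof.
by move=> /between[K /c_cvg cK rK]; exact: is_cvg_pseries_diffs cK rK.
Qed.

Lemma c2_cvg_in r : `|r| < 1 -> cvgn (pseries (pseries_diffs (pseries_diffs c)) r).
Proof.
move=> /between[K /andP[K0 K1] rK].
have /c1_cvg_in cK : `|K| < 1 by rewrite ger0_norm.
exact: is_cvg_pseries_diffs cK rK.
Qed.

(** [pseries_snd_diffs] wants a series and its first two formal derivatives to converge; used for
    the derivative of [psum c], it reaches the third. *)
Lemma c3_cvg_in r : `|r| < 1 ->
  cvgn (pseries (pseries_diffs (pseries_diffs (pseries_diffs c))) r).
Proof.
move=> /between[K /andP[K0 K1] rK].
have /c2_cvg_in cK : `|K| < 1 by rewrite ger0_norm.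
exact: is_cvg_pseries_diffs cK rK.
Qed.

Lemma is_derive_psum r : `|r| < 1 -> is_derive r 1 (psum c) (psum (pseries_diffs c) r).
Proof.
move=> /between[K /andP[K0 K1] rK]; have K1' : `|K| < 1 by rewrite ger0_norm.
by apply: (@pseries_snd_diffs _ _ K) => //;
  [exact: c_cvg_in|exact: c1_cvg_in|exact: c2_cvg_in].
Qed.

Lemma is_derive_psum1 r : `|r| < 1 ->
  is_derive r 1 (psum (pseries_diffs c)) (psum (pseries_diffs (pseries_diffs c)) r).
Proof.
move=> /between[K /andP[K0 K1] rK]; have K1' : `|K| < 1 by rewrite ger0_norm.
by apply: (@pseries_snd_diffs _ _ K) => //;
  [exact: c1_cvg_in|exact: c2_cvg_in|exact: c3_cvg_in].
Qed.

Lemma psum_ge1 r : 0 <= r < 1 -> 1 <= psum c r.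
Proof.
move=> rI; apply: limr_ge; first exact: c_cvg.
exists 1%N => // n /= n0; rewrite /pseries /series/= -(prednK n0) big_nat_recl//=.
rewrite c0 expr0 mul1r lerDl sumr_ge0// => i _.
by rewrite mulr_ge0// exprn_ge0//; case/andP: rI.
Qed.

(* For every [t], [sum_n c_n r^(n-1) (n - r t)^2] is at least the sum of its
   terms [n = 0] and [n = 1]. *)
Lemma psum_quadratic_ge r t : 0 <= r < 1 ->
  r * t ^+ 2 + c 1%N * (1 - r * t) ^+ 2 <=
  r * psum (pseries_diffs (pseries_diffs c)) r + psum (pseries_diffs c) r
  - 2 * (r * t) * psum (pseries_diffs c) r + r * t ^+ 2 * psum c r.
Proof.
move=> rI; have [r0 r1] := andP rI; have r1' : `|r| < 1 by rewrite ger0_norm.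
pose S0 := pseries c r; pose S1 := pseries (pseries_diffs c) r.
pose S2 := pseries (pseries_diffs (pseries_diffs c)) r.
(* The staggered truncations all stop at the coefficient c_(n+1), so the squares are completed
   exactly at each finite stage. *)
pose u n := r * S2 n + S1 n.+1 - 2 * (r * t) * S1 n.+1 + r * t ^+ 2 * S0 n.+2.
have uE n : u n = r * t ^+ 2 +
    \sum_(0 <= i < n.+1) c i.+1 * r ^+ i * (i.+1%:R - r * t) ^+ 2.
  rewrite /u /S0 /S1 /S2 /pseries /series/=; elim: n => [|n IH].
    rewrite !big_nat_recr//= !big_geq// /pseries_diffs c0 !expr0 expr1; ring.
  rewrite [in RHS]big_nat_recr//= addrA -IH.
  rewrite [\sum_(0 <= _ < n.+3) _]big_nat_recr//=.
  rewrite [\sum_(0 <= _ < n.+2) (pseries_diffs c _ * _)]big_nat_recr//=.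
  rewrite [X in r * X]big_nat_recr//= /pseries_diffs !exprS -!natr1; ring.
have cu : u @ \oo --> r * psum (pseries_diffs (pseries_diffs c)) r +
    psum (pseries_diffs c) r - 2 * (r * t) * psum (pseries_diffs c) r +
    r * t ^+ 2 * psum c r.
  have v0 : (fun n => S0 n.+2) @ \oo --> psum c r.
    by rewrite (cvg_shiftS (fun n => S0 n.+1)) (cvg_shiftS S0); exact: c_cvg_in.
  have v1 : (fun n => S1 n.+1) @ \oo --> psum (pseries_diffs c) r.
    by rewrite (cvg_shiftS S1); exact: c1_cvg_in.
  have v2 : S2 @ \oo --> psum (pseries_diffs (pseries_diffs c)) r.
    exact: c2_cvg_in.
  apply: cvgD; first apply: cvgB; first apply: cvgD => //.
  - by apply: cvgM => //; exact: cvg_cst.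
  - by apply: cvgM => //; exact: cvg_cst.
  - by apply: cvgM => //; exact: cvg_cst.
rewrite -(cvg_lim _ cu)//; apply: limr_ge; first by apply/cvg_ex; eexists; exact: cu.
apply: nearW => n; rewrite uE lerD2l big_nat_recl//= expr0 mulr1 lerDl sumr_ge0// => i _.
apply: mulr_ge0; last exact: sqr_ge0.
by rewrite mulr_ge0// exprn_ge0.
Qed.

Lemma psum_wronskian_eq0 r : 0 <= r < 1 ->
  psum (pseries_diffs c) r / psum c r + r * ((psum (pseries_diffs (pseries_diffs c)) r
    * psum c r - psum (pseries_diffs c) r ^+ 2) / psum c r ^+ 2) = 0 ->
  c 1%N = 0.
Proof.
move=> rI; have [r0 r1] := andP rI.
have g0 : psum c r != 0 by rewrite gt_eqF// (lt_le_trans ltr01)// psum_ge1.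
have := psum_quadratic_ge (psum (pseries_diffs c) r / psum c r) rI.
move: (psum (pseries_diffs (pseries_diffs c)) r) (psum (pseries_diffs c) r) (psum c r)
  g0 => g2 g1 g g0 + E.
set t := g1 / g.
have -> : r * g2 + g1 - 2 * (r * t) * g1 + r * t ^+ 2 * g = 0.
  transitivity (g * (g1 / g + r * ((g2 * g - g1 ^+ 2) / g ^+ 2))).
    by rewrite /t; field.
  by rewrite E mulr0.
have t2 : 0 <= r * t ^+ 2 by rewrite mulr_ge0// sqr_ge0.
have u2 : 0 <= c 1%N * (1 - r * t) ^+ 2 by rewrite mulr_ge0// sqr_ge0.
move=> sum0; have {}t2 : r * t ^+ 2 = 0 by lra.
have /eqP : c 1%N * (1 - r * t) ^+ 2 = 0 by lra.
rewrite mulf_eq0 sqrf_eq0 => /orP[/eqP//|].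
(* This holds whichever of r and t vanishes, so r = 0 is no separate case. *)
have -> : r * t = 0.
  by move/eqP: t2; rewrite mulf_eq0 sqrf_eq0 => /orP[] /eqP ->; rewrite ?mul0r ?mulr0.
by rewrite subr0 oner_eq0.
Qed.

End PowerSeries.

(** * Curvature *)

Section LogCurvature.
Variable R : realType.
Local Notation C := R[i].
Implicit Types (F h : C -> C) (z v w d : C).

Lemma cReZ (k : R) z : complex.Re (k%:C%C * z) = k * complex.Re z.
Proof. by rewrite cReM/= mul0r subr0. Qed.

Lemma cImZ (k : R) z : complex.Im (k%:C%C * z) = k * complex.Im z.
Proof. by rewrite cImM/= mul0r addr0. Qed.

Lemma derive1_near_eq (f g : R -> R) (x d : R) :
  (\forall t \near x, g t = f t) -> is_derive x 1 g d -> derive1 f x = d.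
Proof.
move=> fg dg; have [_ <-] := near_eq_is_derive fg dg.
exact: derive1E.
Qed.

Lemma is_derive_sqmod_line F z v d : is_derive (z : C^o) 1 (F : C^o -> C^o) d ->
  is_derive (0 : R) 1 (fun t : R => sqmod (F (z + t%:C%C * v)))
    (2 * complex.Re ((F z)^* * (d * v))).
Proof.
have z0 : z + (0 : R)%:C%C * v = z by rewrite rmorph0 mul0r addr0.
move=> dF; have [] := @is_derive_line R F z v d 0; first by rewrite z0.
set f := fun t => complex.Re _; set g := fun t => complex.Im _ => df dg.
have -> : (fun t : R => sqmod (F (z + t%:C%C * v))) = (f * f + g * g).
  by apply/funext => t; rewrite sqmodE !expr2.
have := is_deriveD (is_deriveM df df) (is_deriveM dg dg).
have [-> ->] : f 0 = complex.Re (F z) /\ g 0 = complex.Im (F z) by rewrite /f /g z0.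
move=> D; apply: is_derive_eq D _.
by rewrite -![_ *: _]/(_ * _) [RHS](_ : _ = 2 * (complex.Re (F z) * complex.Re (d * v) +
  complex.Im (F z) * complex.Im (d * v))); [ring|rewrite [in LHS]cReM cRe_conj cIm_conj; ring].
Qed.

(** The setting: ln N splits into ln |h|^2 and a radial part psi(|z|^2), with [phi] the derivative
    of [psi]. *)
Variables (h : C -> C) (w0 : C) (rho : R) (N : C -> R) (psi phi : R -> R).
Hypothesis rho0 : 0 < rho.
Hypothesis dh : forall u, cmod u < rho -> derivable (h : C^o -> C^o) (w0 + u : C^o) 1.
Hypothesis h_neq0 : forall u, cmod u < rho -> h (w0 + u) != 0.
Hypothesis dpsi : forall u, cmod u < rho ->
  is_derive (sqmod (w0 + u)) 1 psi (phi (sqmod (w0 + u))).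
Hypothesis NE : forall u, cmod u < rho ->
  ln (N (w0 + u)) = ln (sqmod (h (w0 + u))) + psi (sqmod (w0 + u)).

Let logN z : C := (ln (N z))%:C%C.
Let p z : C := 'D_1 (h : C^o -> C^o) (z : C^o) / h z.

Let near_line u v : cmod u < rho -> \forall t \near (0 : R), cmod (u + t%:C%C * v) < rho.
Proof.
move=> ur; exists ((rho - cmod u) / (cmod v + 1)).
  by rewrite /= divr_gt0 ?subr_gt0// ltr_wpDl// cmod_ge0.
move=> t /=; rewrite sub0r normrN ltr_pdivlMr; last by rewrite ltr_wpDl// cmod_ge0.
move=> tr; apply: le_lt_trans (cmodD _ _) _; rewrite cmodM cmodR -ltrBrDl.
by apply: le_lt_trans tr; rewrite ler_wpM2l// lerDl.
Qed.

Lemma real_dderive_log u v : cmod u < rho ->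
  real_dderive v logN (w0 + u) =
  (2 * complex.Re (p (w0 + u) * v) +
   phi (sqmod (w0 + u)) * (2 * complex.Re ((w0 + u)^* * v)))%:C%C.
Proof.
move=> ur; rewrite /real_dderive; set z := w0 + u; congr (_ +i* _)%C; last first.
  by rewrite /logN/= derive1_cst.
have z0 : z + (0 : R)%:C%C * v = z by rewrite rmorph0 mul0r addr0.
have d1 := is_derive_sqmod_line v (derivableP (dh ur)).
have d2 := is_derive_sqmod_line v (is_derive_id (z : C^o) (1 : C^o)).
have s0 : 0 < sqmod (h (z + (0 : R)%:C%C * v)) by rewrite z0 sqmod_gt0 h_neq0.
have d3 := is_derive_chain d1 (is_derive1_ln s0).
have dp : is_derive (sqmod (z + (0 : R)%:C%C * v)) 1 psi (phi (sqmod z)).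
  by rewrite z0; exact: dpsi.
have d4 := is_derive_chain d2 dp.
have d5 := is_deriveD d3 d4.
apply: (@derive1_near_eq _ _ _ _ _ (is_derive_eq d5 _)); last first.
  rewrite z0 -/z; congr (_ + _); last by rewrite mul1r.
  have hz : h z != 0 by exact: h_neq0.
  rewrite /p mulrCA; congr (_ * _).
  rewrite -[in LHS](divfK hz ('D_1 (h : C^o -> C^o) (z : C^o))).
  rewrite -/(p z); set q := p z.
  have -> : (h z)^* * (q * h z * v) = (h z * (h z)^*) * (q * v) by ring.
  rewrite -normCK -sqmodC cReZ mulKf//.
  by rewrite sqmod_eq0.
have := near_line v ur; apply: filterS => t tr.
by rewrite /logN/= /z -[w0 + u + t%:C%C * v]addrA NE// addrA.
Qed.

(** Established on a whole disc, not just at [w0], since the result is differentiated once more. *)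
Lemma wirtinger_bar_log u : cmod u < rho ->
  wirtinger_bar logN (w0 + u) = (p (w0 + u))^* + (phi (sqmod (w0 + u)))%:C%C * (w0 + u).
Proof.
move=> ur; rewrite /wirtinger_bar !real_dderive_log//; set z := w0 + u.
have E (a b : R) : ((2 * a)%:C%C + 'i%C * (2 * b)%:C%C) / 2 = (a +i* b)%C.
  rewrite !rmorphM/= mulrCA -mulrDr rmorph_nat mulrC mulKf ?pnatr_eq0//.
  by rewrite [RHS]complexE.
rewrite !(mulrCA (phi _)) -!mulrDr E !ReiNIm !mulr1.
apply/eqP; rewrite eq_complex cReD cImD cReZ cImZ !cRe_conj !cIm_conj opprK.
by rewrite !eqxx.
Qed.

(* [ln |h|^2] contributes nothing, being the real part of twice a logarithm of
   [h]. *)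
Lemma wirtinger_log (dphi : R) : is_derive (sqmod w0) 1 phi dphi ->
  complex.Re (wirtinger (wirtinger_bar logN) w0) =
  phi (sqmod w0) + sqmod w0 * dphi.
Proof.
move=> dph; have r00 : cmod 0 < rho by rewrite cmod0.
have dh0 := dh r00; rewrite addr0 in dh0.
(* Here the regularity of h' enters: it makes h'/h complex differentiable at [w0]. *)
have ddh := derivable_derive rho0 dh.
have h0 : h w0 != 0 by have := h_neq0 r00; rewrite addr0.
have dp : derivable (p : C^o -> C^o) (w0 : C^o) 1.
  exact: (@derivableM C C^o _ _ _ _ ddh (@derivableV C C^o h w0 1 h0 dh0)).
have {dp} := derivableP dp; set q : C := 'D_1 (p : C^o -> C^o) (w0 : C^o) => dp.
have w00 v : w0 + (0 : R)%:C%C * v = w0 by rewrite rmorph0 mul0r addr0.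
have near_bar v : \forall t \near (0 : R),
    (p (w0 + t%:C%C * v))^* + (phi (sqmod (w0 + t%:C%C * v)))%:C%C * (w0 + t%:C%C * v) =
    wirtinger_bar logN (w0 + t%:C%C * v).
  have := near_line v r00; apply: filterS => t; rewrite add0r => tr.
  by rewrite wirtinger_bar_log.
have dphi_line v := is_derive_chain (is_derive_sqmod_line v (is_derive_id (w0 : C^o) (1 : C^o)))
  (eq_ind_r (fun x => is_derive (sqmod x) 1 phi dphi) dph (w00 v)).
have dp0 v : is_derive (w0 + (0 : R)%:C%C * v : C^o) 1 (p : C^o -> C^o) q.
  by rewrite w00.
have [dRe _] := is_derive_line (dp0 1).
have [_ dIm] := is_derive_line (dp0 'i%C).
have [dX _] := @is_derive_line R id w0 1 1 0 (is_derive_id (_ : C^o) (1 : C^o)).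
have [_ dY] := @is_derive_line R id w0 'i%C 1 0 (is_derive_id (_ : C^o) (1 : C^o)).
have A1 : derive1 (fun t : R => complex.Re (wirtinger_bar logN (w0 + t%:C%C * 1))) 0 =
    complex.Re q + (phi (sqmod w0) + complex.Re w0 * (dphi * (2 * complex.Re w0))).
  have D := is_deriveD dRe (is_deriveM (dphi_line 1) dX).
  apply: (derive1_near_eq _ (is_derive_eq D _)).
    apply: filterS (near_bar 1) => t <-.
    by rewrite cReD cReZ cRe_conj.
  rewrite /= w00 !mulr1 cRe_conj -[phi _ *: _]/(_ * _) -[complex.Re w0 *: _]/(_ * _).
  by rewrite mulr0 subr0 mulr1.
have A2 : derive1 (fun t : R => complex.Im (wirtinger_bar logN (w0 + t%:C%C * 'i%C))) 0 =
    - complex.Re q + (phi (sqmod w0) + complex.Im w0 * (dphi * (2 * complex.Im w0))).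
  have D := is_deriveD (is_deriveN dIm) (is_deriveM (dphi_line 'i%C) dY).
  apply: (derive1_near_eq _ (is_derive_eq D _)).
    apply: filterS (near_bar 'i%C) => t <-.
    by rewrite cImD cImZ cIm_conj.
  rewrite /= w00 !mul1r ImiRe ReiNIm cIm_conj opprK.
  by rewrite -[phi _ *: _]/(_ * _) -[complex.Im w0 *: _]/(_ * _) /=; ring.
(* The real part involves only Re of the x-derivative and Im of the y-derivative; there the
   holomorphic part contributes Re q and - Re q, which cancel. *)
have E (A B : C) : complex.Re ((A - 'i%C * B) / 2) = (complex.Re A + complex.Im B) / 2.
  have -> : (2 : C)^-1 = (2^-1 : R)%:C%C by rewrite fmorphV rmorph_nat.
  by rewrite mulrC cReZ cReB cReM/= mul0r mul1r sub0r opprK mulrC.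
rewrite /wirtinger E /real_dderive /= A1 A2.
move: (complex.Re q) (phi _) => a b; rewrite sqmodE.
by move: (complex.Re w0) (complex.Im w0) => x y; field.
Qed.

End LogCurvature.

Lemma derivable_inner (R : realType) (H : hilbertType R) (gamma : R[i] -> H)
    (y : H) (z : R[i]) :
  derivable (gamma : R[i]^o -> H) (z : R[i]^o) 1 ->
  derivable ((fun w => inner (gamma w) y) : R[i]^o -> R[i]^o) (z : R[i]^o) 1.
Proof.
move=> /cvg_ex[l gl]; apply/cvg_ex; exists (inner l y).
apply/(@cvgrPdist_lt R[i] R[i]^o) => d d0.
have K0 : 0 < `|y| + 1 by rewrite ltr_wpDl.
move: gl => /(@cvgrPdist_lt R[i] H) /(_ _ (divr_gt0 d0 K0)); apply: filterS => u ul.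
rewrite -[_ *: _]/(_ * _) -innerBl -innerZl -innerBl.
apply: le_lt_trans (cauchy_schwarz _ _) _.
apply: (@le_lt_trans _ _ (`|l - u^-1 *: (gamma (u *: 1 + z) - gamma z)| * (`|y| + 1))).
  by rewrite ler_wpM2l// lerDl.
by rewrite -ltr_pdivlMr.
Qed.

Lemma norm_lt1 (R : realType) (z : R[i]) : (`|z| < 1) = (cmod z < 1).
Proof. exact: ltcR. Qed.

(** * Extremal curvature forces the first weight to have modulus 1 *)

Section ShiftCurvature.
Variables (R : realType) (H : hilbertType R).
Local Notation C := R[i].
Variables (T : {linear H -> H}) (Ts : H -> H) (e : nat -> H) (lambda : nat -> C).
Hypotheses (adj : is_adjoint T Ts) (e_basis : orthonormal_basis e).
Hypothesis TsE : forall n, Ts (e n) = lambda n *: e n.+1.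
Hypothesis ker1 : forall w, unit_disc w -> one_dimensional (eigen_kernel T w).
Hypothesis lambda_le1 : forall n, sqmod (lambda n) <= 1.

(* An eigenvector [x] at [z] with [inner x (e 0) = 1] satisfies
   [|inner x (e n)|^2 = shift_coef n * |z|^(2 n)]. *)
Definition shift_coef n : R := \prod_(0 <= k < n) (sqmod (lambda k))^-1.
Local Notation a := shift_coef.
Local Notation c := (increments a).

Let lambda_neq0 n : lambda n != 0.
Proof.
apply: (shift_weight_neq0 adj e_basis TsE); apply: ker1.
by rewrite /unit_disc/= normr0.
Qed.

Let a0 : a 0%N = 1. Proof. by rewrite /a big_geq. Qed.

Let aS n : a n <= a n.+1.
Proof.
rewrite /a big_nat_recr//= ler_peMr//.
  by apply: prodr_ge0 => i _; rewrite invr_ge0 sqmod_ge0.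
by rewrite invf_ge1 ?sqmod_gt0.
Qed.

Let eigen_parseval x z : T x = z *: x ->
  series (fun n => sqmod (inner x (e 0%N)) * (a n * sqmod z ^+ n)) @ \oo --> nsq x.
Proof.
move=> Tx; have := @parseval R H e e_basis.1 x e_basis.2.
by under eq_fun do rewrite (shift_eigenvector adj TsE _ lambda_neq0 Tx).
Qed.

Lemma eigen_coord0_neq0 x z : T x = z *: x -> x != 0 -> inner x (e 0%N) != 0.
Proof.
move=> Tx; apply: contra => /eqP x0; apply/eqP.
apply: (basis_total e_basis) => n; apply/eqP; rewrite -sqmod_eq0.
by rewrite (shift_eigenvector adj TsE _ lambda_neq0 Tx) x0 /sqmod normr0 expr0n/= mul0r.
Qed.

(** No growth estimate is made: an eigenvector at z = sqrt r exists, and Parseval sums the series to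
    its squared norm up to a nonzero factor. *)
Let a_cvg r : 0 <= r < 1 -> cvgn (pseries a r).
Proof.
move=> /andP[r0 r1]; pose z : C := (Num.sqrt r)%:C%C.
have zr : sqmod z = r by rewrite sqmod_cmod cmodR real_normK ?num_real// sqr_sqrtr.
have zdisc : unit_disc z.
  by rewrite /unit_disc/= norm_lt1 -(@expr_lt1 _ 2) ?cmod_ge0// -sqmod_cmod zr.
have [x x0 kerE] := ker1 zdisc.
have Tx : T x = z *: x.
  apply/eqP; rewrite -subr_eq0; apply/eqP.
  suff : eigen_kernel T z x by [].
  by rewrite kerE; exists 1 => //; rewrite scale1r.
have := eigen_parseval Tx; rewrite zr => P.
have h0 := eigen_coord0_neq0 Tx x0; rewrite -sqmod_eq0 in h0.
have := @is_cvg_seriesZ _ _ (sqmod (inner x (e 0%N)))^-1 (cvgP _ P).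
rewrite [X in series X](_ : _ = fun n => a n * r ^+ n)//; apply/funext => n.
by rewrite -[LHS]/(_ * (_ * _)) mulKf.
Qed.

Lemma eigen_nsq x z : T x = z *: x -> cmod z < 1 ->
  nsq x = sqmod (inner x (e 0%N)) * psum a (sqmod z).
Proof.
move=> Tx z1; have rI : 0 <= sqmod z < 1.
  by rewrite sqmod_ge0 sqmod_cmod expr_lt1// cmod_ge0.
have P := eigen_parseval Tx; rewrite -(cvg_lim _ P)//.
exact: (lim_seriesZ _ (a_cvg rI)).
Qed.

Let c0 : c 0%N = 1. Proof. exact: a0. Qed.

Let c_ge0 n : 0 <= c n.
Proof. by apply: increments_ge0; rewrite ?a0. Qed.

Let c_cvg r : 0 <= r < 1 -> cvgn (pseries c r).
Proof. by move=> /a_cvg/cvg_pseries_increments/cvgP. Qed.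

Let psum_c r : 0 <= r < 1 -> psum c r = (1 - r) * psum a r.
Proof. by move=> /a_cvg/cvg_pseries_increments cv; exact: cvg_lim cv. Qed.

Let c_gt0 r : 0 <= r < 1 -> 0 < psum c r.
Proof. by move=> rI; apply: lt_le_trans ltr01 _; exact: psum_ge1. Qed.

Let g1 := pseries_diffs c.
Let g2 := pseries_diffs g1.

Let psi (r : R) : R := ln (psum c r) - ln (1 - r).
Let phi (r : R) : R := psum g1 r / psum c r + (1 - r)^-1.

Let d1B (r : R) : is_derive r 1 (fun x => 1 - x) (- 1).
Proof.
have := is_deriveB (is_derive_cst (1 : R) r 1) (is_derive_id r 1).
by rewrite sub0r.
Qed.

Let is_derive_psi (r : R) : 0 <= r < 1 -> is_derive r 1 psi (phi r).
Proof.
move=> rI; have [r0 r1] := andP rI; have r1' : `|r| < 1 by rewrite ger0_norm.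
have r1B : 0 < 1 - r by rewrite subr_gt0.
have D1 := is_derive_chain (is_derive_psum c_cvg r1') (is_derive1_ln (c_gt0 rI)).
have D2 := is_derive_chain (d1B r) (is_derive1_ln r1B).
apply: is_derive_eq (is_deriveB D1 D2) _.
by rewrite /phi mulrN1 opprK mulrC.
Qed.

Let is_derive_phi (r : R) : 0 <= r < 1 -> is_derive r 1 phi
  ((psum g2 r * psum c r - psum g1 r ^+ 2) / psum c r ^+ 2 + (1 - r) ^- 2).
Proof.
move=> rI; have [r0 r1] := andP rI; have r1' : `|r| < 1 by rewrite ger0_norm.
have g0 := lt0r_neq0 (c_gt0 rI).
have r1B : 1 - r != 0 by rewrite subr_eq0 eq_sym lt_eqF.
have D1 := is_deriveM (is_derive_psum1 c_cvg r1') (is_deriveV g0 (is_derive_psum c_cvg r1')).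
have D2 := @is_deriveV R (fun x => 1 - x) r (-1) 1 r1B (d1B r).
apply: is_derive_eq (is_deriveD D1 D2) _.
rewrite -![_ *: _]/(_ * _) -/g1 -/g2.
move: (psum g2 r) (psum g1 r) (psum c r) g0 => x y z z0.
by field; rewrite ?z0 ?r1B.
Qed.

Lemma shift_curvature_extremal w0 : unit_disc w0 ->
  is_curvature T w0 (- ((1 - `|w0| ^+ 2) ^- 2)) -> sqmod (lambda 0%N) = 1.
Proof.
move=> w0_disc [gamma sec kE].
have w01 : cmod w0 < 1 by rewrite -norm_lt1.
have [rho rho0 rhoP] : exists2 rho : R, 0 < rho & forall u, cmod u < rho ->
    [/\ gamma (w0 + u) != 0, eigen_kernel T (w0 + u) (gamma (w0 + u)),
        derivable (gamma : C^o -> H) (w0 + u : C^o) 1 & cmod (w0 + u) < 1].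
  have [_ /ltc_real[t t0 ->] tP] := sec.
  (* Keeps w0 + u both in the neighbourhood where [gamma] is a section and in the unit disc. *)
  exists (Num.min t (1 - cmod w0)); first by rewrite lt_min t0 subr_gt0.
  move=> u; rewrite lt_min ltrBrDl => /andP[ut u1].
  have [|? ? ?] := tP (w0 + u); last by split=> //; exact: le_lt_trans (cmodD _ _) u1.
  by rewrite /= opprD addrA subrr sub0r normrN; move: ut; rewrite -ltcR.
pose h z := inner (gamma z) (e 0%N); pose N z := complex.Re (`|gamma z| ^+ 2).
have Tgamma u : cmod u < rho -> T (gamma (w0 + u)) = (w0 + u) *: gamma (w0 + u).
  by move=> /rhoP[_ + _ _] => /eqP; rewrite subr_eq0 => /eqP.
have rI u : cmod u < rho -> 0 <= sqmod (w0 + u) < 1.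
  by move=> /rhoP[_ _ _ u1]; rewrite sqmod_ge0 sqmod_cmod expr_lt1// cmod_ge0.
have dh u : cmod u < rho -> derivable (h : C^o -> C^o) (w0 + u : C^o) 1.
  by move=> /rhoP[_ _ + _]; exact: derivable_inner.
have h_neq0 u : cmod u < rho -> h (w0 + u) != 0.
  by move=> ur; have [g0 _ _ _] := rhoP u ur; exact: eigen_coord0_neq0 (Tgamma u ur) g0.
have NE u : cmod u < rho ->
    ln (N (w0 + u)) = ln (sqmod (h (w0 + u))) + psi (sqmod (w0 + u)).
  move=> ur; have [_ _ _ u1] := rhoP u ur; have r1 := rI u ur.
  have r1B : 0 < 1 - sqmod (w0 + u) by rewrite subr_gt0; case/andP: r1.
  rewrite /N norm_nsq /= (eigen_nsq (Tgamma u ur) u1).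
  have -> : psum a (sqmod (w0 + u)) = psum c (sqmod (w0 + u)) / (1 - sqmod (w0 + u)).
    by rewrite psum_c// mulrC mulKf// gt_eqF.
  have p1 := c_gt0 r1.
  by rewrite lnM ?posrE ?divr_gt0 ?sqmod_gt0 ?h_neq0// ln_div ?posrE.
have r00 : cmod 0 < rho by rewrite cmod0.
have := rI 0 r00; rewrite addr0 => r01.
have W := wirtinger_log rho0 dh h_neq0 (fun u ur => is_derive_psi (rI u ur)) NE (is_derive_phi r01).
have : complex.Re (wirtinger (wirtinger_bar (log_norm2 gamma)) w0) = (1 - sqmod w0) ^- 2.
  move/oppr_inj: kE => <-.
  by rewrite -sqmodC -(rmorph1 (real_complex R)) -rmorphB -rmorphXn -fmorphV.
rewrite [LHS]W => {}W.
have r1B : 1 - sqmod w0 != 0 by rewrite gt_eqF// subr_gt0; case/andP: r01.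
have c10 : c 1%N = 0.
  apply: (psum_wronskian_eq0 c0 c_ge0 c_cvg r01).
  move: W; rewrite /phi -/g1 -/g2 mulrDr.
  (* The factor 1 / (1 - r) already accounts for the whole curvature, so the contribution of
     [psum c] must vanish. *)
  have : (1 - sqmod w0)^-1 + sqmod w0 * (1 - sqmod w0) ^- 2 = (1 - sqmod w0) ^- 2 by field.
  lra.
(* The coefficient c_1 is |lambda 0|^-2 - 1. *)
move: c10; rewrite /increments a0 /a big_nat1 => /subr0_eq l1.
by rewrite -[LHS]invrK l1 invr1.
Qed.

End ShiftCurvature.

Theorem proposition3p4 (R : realType) (H : hilbertType R)
    (H_separable : separable H) (T : {linear H -> H})
    (T_contractive : contractive T) (T_cohyponormal : cohyponormal T)
    (T_shift : backward_weighted_shift T) (T_B1 : CowenDouglas_B1 T)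
    (w0 : R[i]) (w0_disc : unit_disc w0)
    (T_curvature : is_curvature T w0 (- ((1 - `|w0| ^+ 2) ^- 2))) :
  unitarily_equivalent T (@backward_shift R).
Proof.
have [Ts [adj [e [lambda [e_basis TsE]]]]] := T_shift.
have [_ ker1 _ _] := T_B1.
have le1 n := shift_weight_le1 adj e_basis TsE n T_contractive.
have l0 := shift_curvature_extremal adj e_basis TsE ker1 le1 w0_disc T_curvature.
apply: (shift_unitary adj e_basis TsE) => n.
apply/eqP; rewrite eq_le le1 /=; elim: n => [|n IH]; first by rewrite l0.
exact: le_trans IH (shift_weight_nondecreasing adj e_basis TsE n T_cohyponormal).
Qed.
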